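(* Let $n\ge2$. The real group-valued (quasi-Hamiltonian) universal symplectic implosion of $SU(n)$ is identified with a stratified subset of the multiplicative universal complex-symplectic implosion $\tilde Q_{\rm mult}$ for $SL(n,\mathbb{C})$, namely the $SU(n)$-sweep of the points $[A(\theta)]$, $\theta\in\Delta$. Explicitly, for $k,k'\in SU(n)$ and $\theta,\theta'\in\Delta$, one has $$k\cdot[A(\theta)]=k'\cdot[A(\theta')]\ \text{ in }\tilde Q_{\rm mult}\iff \theta=\theta'\ \text{ and }\ k^{-1}k'\in[K_\theta,K_\theta].$$ Thus $(k,\theta)\mapsto k\cdot[A(\theta)]$ induces an $SU(n)$-equivariant bijection from the implosion $(SU(n)\times\Delta)/\!\sim$ onto $\{k\cdot[A(\theta)]:k\in SU(n),\theta\in\Delta\}\subset\tilde Q_{\rm mult}$. Under this bijection each open face $\sigma$ of $\Delta$ contributes a stratum $SU(n)\times_{SU(n_1)\times\cdots\times SU(n_r)}\mathcal{Y}_\sigma$, where $n_1,\dots,n_r$ are the multiplicities of the eigenvalues of $t(\theta)$ for $\theta\in\sigma$, $\mathcal{Y}_\sigma=\{t(\theta):\theta\in\sigma\}$, and $SU(n_1)\times\cdots\times SU(n_r)=[K_\theta,K_\theta]$. In particular the open stratum is $SU(n)\times\mathcal{Y}_{\sigma}$ with $\sigma$ the interior of $\Delta$, and each vertex of $\Delta$ contributes a single point.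
   Context: **The space $\tilde Q_{\rm mult}$.** A full flag quiver consists of linear maps $\alpha_i:\mathbb{C}^i\to\mathbb{C}^{i+1}$ and $\beta_i:\mathbb{C}^{i+1}\to\mathbb{C}^i$, $i=1,\dots,n-1$. Consider the affine variety of tuples consisting of a full flag quiver with all $1+\alpha_i\beta_i$ and $1+\beta_i\alpha_i$ invertible, together with $\tilde q_0,\dots,\tilde q_{n-1}\in\mathbb{C}^*$ with $\tilde q_0\cdots\tilde q_{n-1}=1$, satisfying $$\tilde q_i(1+\beta_{i+1}\alpha_{i+1})=\tilde q_{i+1}(1+\alpha_i\beta_i)\qquad(0\le i\le n-2),\qquad \alpha_0\beta_0:=0.$$ The group $H_{\mathbb{C}}=\prod_{i=1}^{n-1}SL(i,\mathbb{C})$ acts by $\alpha_i\mapsto g_{i+1}\alpha_ig_i^{-1}$, $\beta_i\mapsto g_i\beta_ig_{i+1}^{-1}$ for $i\le n-2$, and $\alpha_{n-1}\mapsto\alpha_{n-1}g_{n-1}^{-1}$, $\beta_{n-1}\mapsto g_{n-1}\beta_{n-1}$, trivially on the scalars. $\tilde Q_{\rm mult}$ is the GIT quotient of this variety by $H_{\mathbb{C}}$ (it can also be identified with $(SL(n,\mathbb{C})\times B)/\!/N$, with $B$ the standard Borel subgroup and $N$ its maximal unipotent subgroup). The group $SL(n,\mathbb{C})\supset SU(n)$ acts on $\tilde Q_{\rm mult}$ by $\alpha_{n-1}\mapsto g\alpha_{n-1}$, $\beta_{n-1}\mapsto\beta_{n-1}g^{-1}$. The class of a tuple $A$ in $\tilde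 Q_{\rm mult}$ is written $[A]$. **The alcove.** $\Delta=\{\theta\in\mathbb{R}^n:\sum_{i}\theta_i=0,\ \theta_1-2\pi\le\theta_n\le\theta_{n-1}\le\cdots\le\theta_2\le\theta_1\}$. For $\theta\in\Delta$ let $t(\theta)=\mathrm{diag}(e^{i\theta_n},e^{i\theta_{n-1}},\dots,e^{i\theta_1})\in SU(n)$, let $K_\theta$ be the centralizer of $t(\theta)$ in $SU(n)$, and let $[K_\theta,K_\theta]$ be its commutator subgroup (a product of special unitary groups, one acting on each eigenspace of $t(\theta)$). **The universal group-valued symplectic implosion of $SU(n)$** (Hurtubise–Jeffrey–Sjamaar) is the quotient $(SU(n)\times\Delta)/\!\sim$, where $(k,\theta)\sim(k',\theta')$ if and only if $\theta=\theta'$ and $k^{-1}k'\in[K_\theta,K_\theta]$. It is stratified by the open faces of $\Delta$. $SU(n)$ acts by left multiplication. **The toric quivers $A(\theta)$.** Fix a branch of the square root on $\{\mathrm{Re}\,z<0\}$ and put $\sqrt0=0$. For $\theta\in\Delta$ put $\tilde q_{n-j}=e^{-i\theta_j}$ for $1\le j\le n$ and $q_m=\tilde q_m/\tilde q_{m-1}$ for $1\le m\le n-1$ (so that $q_m$ lies in the unit circle and $q_{n-j}=e^{i(\theta_{j+1}-\theta_j)}$). $A(\theta)$ is the tuple with these scalars $\tilde q_m$ and with, for $1\le m\le n-1$, $$\alpha_m=\begin{pmatrix}D_m\\0\end{pmatrix}\ \ ((m+1)\times m),\qquad \beta_m=\begin{pmatrix}D_m&0\end{pmatrix}\ \ (m\times(m+1)),$$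 $$D_m=\mathrm{diag}(\nu^m_1,\dots,\nu^m_m),\qquad \nu^m_j=\sqrt{q_mq_{m-1}\cdots q_j-1}\quad(1\le j\le m).$$ This satisfies the equations above, and $\tilde q_{n-1}^{-1}(1+\alpha_{n-1}\beta_{n-1})=t(\theta)$. *)

(* Defs.v *)
From HB Require Import structures.
From mathcomp Require Import all_boot all_order all_algebra.
From mathcomp Require Import all_classical all_reals all_analysis.
From mathcomp Require Import complex.

Set Implicit Arguments.
Unset Strict Implicit.
Unset Printing Implicit Defensive.

Import Order.TTheory GRing.Theory Num.Theory.
Import numFieldNormedType.Exports.

Local Open Scope classical_set_scope.
Local Open Scope quotient_scope.
Local Open Scope ring_scope.

Definition expi (R : realType) (x : R) : R[i] := (cos x +i* sin x)%C.

Lemma expi0 (R : realType) : expi (0 : R) = 1.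
Proof. by rewrite /expi cos0 sin0. Qed.

Lemma expiD (R : realType) (x y : R) : expi (x + y) = expi x * expi y.
Proof.
by rewrite /expi cosD sinD /GRing.mul /= [in X in (_ +i* X)%C]addrC.
Qed.

Lemma expi_neq0 (R : realType) (x : R) : expi x != 0.
Proof.
apply/eqP => e0; have := expiD x (- x).
by rewrite subrr expi0 e0 mul0r => /eqP; rewrite oner_eq0.
Qed.

Section SpecialUnitary.
Variables (C : numClosedFieldType) (n : nat).

Definition su_pred : {pred 'M[C]_n} :=
  fun k => (k \is unitarymx) && (\det k == 1).

Definition SU := {k : 'M[C]_n | su_pred k}.

HB.instance Definition _ := SubChoice.on SU.

Lemma su_unit (k : SU) : val k \in unitmx.
Proof. by have /andP[/unitarymx_unit] := valP k. Qed.

Lemma su1_subproof : su_pred 1%:M.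
Proof.
rewrite /su_pred det1 eqxx andbT; apply/unitarymxP.
by rewrite trmx1 map_mx1 mulmx1.
Qed.

Lemma suM_subproof (k l : SU) : su_pred (val k *m val l).
Proof.
have /andP[uk /eqP dk] := valP k; have /andP[ul /eqP dl] := valP l.
by rewrite /su_pred mul_unitarymx //= det_mulmx dk dl mulr1.
Qed.

Lemma suV_subproof (k : SU) : su_pred (invmx (val k)).
Proof.
have /andP[uk /eqP dk] := valP k.
rewrite /su_pred det_inv dk invr1 eqxx andbT.
by rewrite invmx_unitary // trmxC_unitary.
Qed.

Definition su1 : SU := exist (fun k => is_true (su_pred k)) _ su1_subproof.
Definition suM (k l : SU) : SU := exist (fun k => is_true (su_pred k)) _ (suM_subproof k l).
Definition suV (k : SU) : SU := exist (fun k => is_true (su_pred k)) _ (suV_subproof k).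

Lemma suMA : associative suM.
Proof. by move=> x y z; apply/val_inj; rewrite /= mulmxA. Qed.
Lemma su1M : left_id su1 suM.
Proof. by move=> x; apply/val_inj; rewrite /= mul1mx. Qed.
Lemma suM1 : right_id su1 suM.
Proof. by move=> x; apply/val_inj; rewrite /= mulmx1. Qed.
Lemma suVM : left_inverse su1 suV suM.
Proof. by move=> x; apply/val_inj; rewrite /= mulVmx ?su_unit. Qed.
Lemma suMV : right_inverse su1 suV suM.
Proof. by move=> x; apply/val_inj; rewrite /= mulmxV ?su_unit. Qed.

HB.instance Definition _ := isGroup.Build SU suMA su1M suM1 suVM suMV.

End SpecialUnitary.

Section CommutatorSubgroup.
Variable G : groupType.
Local Open Scope group_scope.

Definition is_subgroup (H : set G) : Prop :=
  [/\ H 1, forall x y, H x -> H y -> H (x * y) & forall x, H x -> H x^-1].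

Definition commutator_subgroup (K : set G) : set G :=
  smallest is_subgroup [set commg x y | x in K & y in K].

Lemma commutator_subgroupP (K : set G) : is_subgroup (commutator_subgroup K).
Proof.
split=> [H [[]]//|x y Hx Hy H HK|x Hx H HK].
- by have [[_ HM _] _] := HK; apply: HM; [exact: Hx|exact: Hy].
- by have [[_ _ HV] _] := HK; apply: HV; exact: Hx.
Qed.

End CommutatorSubgroup.

(* The index i : 'I_n runs over 0, ..., n-1.  The maps alpha_0 : C^0 -> C^1 and
   beta_0 : C^1 -> C^0 carry no information and give alpha_0 beta_0 = 0. *)
Record quiver (C : numClosedFieldType) (n : nat) := Quiver {
  qalpha : forall i : 'I_n, 'M[C]_(i.+1, i);
  qbeta : forall i : 'I_n, 'M[C]_(i, i.+1);
  qscal : 'I_n -> C }.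

Section Variety.
Variables (C : numClosedFieldType) (n : nat).

(* Dependent indices: Ordinal (ltnW h) and Ordinal h are i and i+1. *)
Definition mult_variety (A : quiver C n) : Prop :=
  [/\ forall i : 'I_n, 1%:M + qalpha A i *m qbeta A i \in unitmx /\
                       1%:M + qbeta A i *m qalpha A i \in unitmx,
      forall i : 'I_n, qscal A i != 0,
      \prod_(i < n) qscal A i = 1 &
      forall (i : nat) (h : (i.+1 < n)%N),
        qscal A (Ordinal (ltnW h)) *:
          (1%:M + qbeta A (Ordinal h) *m qalpha A (Ordinal h)) =
        qscal A (Ordinal h) *:
          (1%:M + qalpha A (Ordinal (ltnW h)) *m qbeta A (Ordinal (ltnW h)))].

Definition mult_var := {A : quiver C n | mult_variety A}.

(* Change of basis by g_i at the vertex C^i, for all 1 <= i <= n at once. *)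
Definition gauge (g : forall i : nat, 'M[C]_i) (A : quiver C n) : quiver C n :=
  Quiver (fun i => g i.+1 *m qalpha A i *m invmx (g i))
         (fun i => g i *m qbeta A i *m invmx (g i.+1))
         (qscal A).

Lemma gauge_conj m p (x : 'M[C]_m) (y : 'M[C]_p) 
    (a : 'M[C]_(m, p)) (b : 'M[C]_(p, m)) :
  x \in unitmx -> y \in unitmx ->
  1%:M + (x *m a *m invmx y) *m (y *m b *m invmx x) =
  x *m (1%:M + a *m b) *m invmx x.
Proof.
move=> ux uy; rewrite mulmxDr mulmx1 mulmxDl mulmxV //; congr (_ + _).
by rewrite !mulmxA mulmxKV.
Qed.

Lemma gauge_mult_variety (g : forall i : nat, 'M[C]_i) (A : quiver C n) :
  (forall i, g i \in unitmx) -> mult_variety A -> mult_variety (gauge g A).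
Proof.
move=> ug [A1 A2 A3 A4]; split=> //= [i|i h].
  rewrite !gauge_conj ?ug // !unitmx_mul !unitmx_inv !ug /=.
  by have [-> ->] := A1 i.
rewrite !gauge_conj ?ug //.
have conjZ m (x y z : 'M[C]_m) c : c *: (x *m y *m z) = x *m (c *: y) *m z.
  by rewrite -scalemxAr -scalemxAl.
by rewrite !conjZ A4.
Qed.

(* An element of H_C, i.e. of the product of the SL(i, C) for 1 <= i <= n-1, is
   a family indexed by all natural numbers that is 1 from the index n on. *)
Definition Hgroup :=
  {h : forall i : nat, 'M[C]_i |
     forall i, \det (h i) = 1 /\ ((n <= i)%N -> h i = 1%:M)}.

Lemma Hgroup_unit (h : Hgroup) i : projT1 h i \in unitmx.
Proof. by rewrite unitmxE; case: h => h /= /(_ i)[->]; rewrite unitr1. Qed.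

Definition hact (h : Hgroup) (A : mult_var) : mult_var :=
  exist _ _ (gauge_mult_variety (Hgroup_unit h) (proj2_sig A)).

(* k at the vertex C^n and the identity at the other vertices *)
Definition at_top (k : 'M[C]_n) (i : nat) : 'M[C]_i := conform_mx 1%:M k.

Lemma at_top_unit (k : SU C n) i : at_top (val k) i \in unitmx.
Proof.
rewrite /at_top; have [->|ni] := eqVneq i n.
  by rewrite conform_mx_id su_unit.
by rewrite nonconform_mx ?unitmx1 // eq_sym ni.
Qed.

Definition kact (k : SU C n) (A : mult_var) : mult_var :=
  exist _ _ (gauge_mult_variety (at_top_unit k) (proj2_sig A)).

(* The coordinate ring of the variety, as functions on its points: generated by
   the matrix entries, the scalars and the inverses of the functions required
   not to vanish. *)
Inductive regular : (mult_var -> C) -> Prop :=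
| RegAlpha (i : 'I_n) a b : regular (fun A => qalpha (sval A) i a b)
| RegBeta (i : 'I_n) a b : regular (fun A => qbeta (sval A) i a b)
| RegScal (i : 'I_n) : regular (fun A => qscal (sval A) i)
| RegScalV (i : 'I_n) : regular (fun A => (qscal (sval A) i)^-1)
| RegDetV (i : 'I_n) : regular (fun A =>
    (\det (1%:M + qalpha (sval A) i *m qbeta (sval A) i))^-1)
| RegDetV' (i : 'I_n) : regular (fun A =>
    (\det (1%:M + qbeta (sval A) i *m qalpha (sval A) i))^-1)
| RegConst c : regular (fun=> c)
| RegAdd f g : regular f -> regular g -> regular (fun A => f A + g A)
| RegMul f g : regular f -> regular g -> regular (fun A => f A * g A).

Definition invariant : {pred (mult_var -> C)} :=
  fun f => `[< regular f /\ forall h A, f (hact h A) = f A >].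

Lemma invariantP f :
  reflect (regular f /\ forall h A, f (hact h A) = f A) (f \in invariant).
Proof. exact: asboolP. Qed.

Lemma invariant_subring : subring_closed invariant.
Proof.
split=> [|f g /invariantP[rf hf] /invariantP[rg hg]
         |f g /invariantP[rf hf] /invariantP[rg hg]]; apply/invariantP.
- by split=> //; exact: RegConst.
- split=> [|h A]; last by rewrite /GRing.add /GRing.opp /= hf hg.
  suff -> : f - g = (fun A => f A + (fun A => (fun=> -1) A * g A) A).
    by do 2?[apply: RegAdd|apply: RegMul] => //; exact: RegConst.
  by apply/funext => A; rewrite mulN1r.
- split=> [|h A]; last by rewrite /GRing.mul /= hf hg.
  exact: RegMul.
Qed.

Lemma invariant_submod : submod_closed invariant.
Proof.
split=> [|c f g /invariantP[rf hf] /invariantP[rg hg]]; apply/invariantP.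
  by split=> //; exact: RegConst.
split=> [|h A]; last by rewrite /GRing.add /GRing.scale /= hf hg.
suff -> : c *: f + g = (fun A => (fun A => (fun=> c) A * f A) A + g A).
  by apply: RegAdd => //; apply: RegMul => //; exact: RegConst.
by apply/funext.
Qed.

HB.instance Definition _ :=
  GRing.isSubringClosed.Build (mult_var -> C) invariant invariant_subring.
HB.instance Definition _ :=
  GRing.isSubmodClosed.Build C (mult_var -> C) invariant invariant_submod.

Definition inv_ring := {f : mult_var -> C | f \in invariant}.

HB.instance Definition _ := SubChoice.on inv_ring.
HB.instance Definition _ :=
  GRing.SubChoice_isSubPzRing.Build _ _ inv_ring invariant_subring.
HB.instance Definition _ := [SubZmodule_isSubLmodule of inv_ring by <:].

(* Points of the affine GIT quotient Spec C[V]^H: the C-algebra morphisms from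
   the ring of invariants to C. *)
Definition is_point (chi : inv_ring -> C) : bool :=
  `[< scalar chi /\ monoid_morphism chi >].

Definition qmult := {chi : inv_ring -> C | is_point chi}.

Lemma eval_is_point (A : mult_var) : is_point (fun f => val f A).
Proof. by apply/asboolP; split. Qed.

(* The class of a tuple: evaluation of the invariants at that tuple. *)
Definition qclass (A : mult_var) : qmult :=
  exist (fun chi => is_true (is_point chi)) _ (eval_is_point A).

Lemma regular_sum (I : finType) (F : I -> mult_var -> C) :
  (forall i, regular (F i)) -> regular (fun A => \sum_i F i A).
Proof.
move=> rF; elim: (index_enum I) => [|i r IH].
  suff -> : (fun A => \sum_(i <- [::]) F i A) = (fun=> 0) by exact: RegConst.
  by apply/funext => A; rewrite big_nil.
suff -> : (fun A => \sum_(j <- i :: r) F j A) =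
    (fun A => F i A + (fun B => \sum_(j <- r) F j B) A).
  by apply: RegAdd.
by apply/funext => A; rewrite big_cons.
Qed.

Lemma regular_mulmx m p q r (x : 'M[C]_(m, p)) (y : 'M[C]_(q, r))
    (M : mult_var -> 'M[C]_(p, q)) :
  (forall a b, regular (fun A => M A a b)) ->
  forall a b, regular (fun A => (x *m M A *m y) a b).
Proof.
move=> rM a b.
suff -> : (fun A => (x *m M A *m y) a b) =
    (fun A => \sum_j (fun B => (\sum_i (fun B' => x a i * M B' i j) B)
                              * y j b) A).
  apply: regular_sum => j; apply: RegMul; last exact: RegConst.
  by apply: regular_sum => i; apply: RegMul => //; exact: RegConst.
by apply/funext => A; rewrite mxE; apply: eq_bigr => j _; rewrite mxE.
Qed.

Lemma regular_kact k f : regular f -> regular (f \o kact k).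
Proof.
have uk := at_top_unit k.
elim=> {f}.
- move=> i a b; apply: regular_mulmx => ? ?; exact: RegAlpha.
- move=> i a b; apply: regular_mulmx => ? ?; exact: RegBeta.
- by move=> i; apply: RegScal.
- by move=> i; apply: RegScalV.
- move=> i; have := RegDetV i; congr regular; apply/funext => A /=.
  by rewrite gauge_conj // !det_mulmx mulrC mulrA -det_mulmx mulVmx // det1 mul1r.
- move=> i; have := RegDetV' i; congr regular; apply/funext => A /=.
  by rewrite gauge_conj // !det_mulmx mulrC mulrA -det_mulmx mulVmx // det1 mul1r.
- by move=> c; apply: RegConst.
- by move=> f g _ rf _ rg; apply: (RegAdd rf rg).
- by move=> f g _ rf _ rg; apply: (RegMul rf rg).
Qed.

Lemma kact_hact k h A : kact k (hact h A) = hact h (kact k A).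
Proof.
have comm i : at_top (val k) i *m projT1 h i = projT1 h i *m at_top (val k) i.
  rewrite /at_top; have [ni|ni] := leqP n i.
    by case: h => h hP /=; have [_ ->] := hP i; rewrite // mulmx1 mul1mx.
  by rewrite nonconform_mx ?gtn_eqF // mulmx1 mul1mx.
have uk := at_top_unit k; have uh := Hgroup_unit h.
have commV i : invmx (projT1 h i) *m invmx (at_top (val k) i) =
               invmx (at_top (val k) i) *m invmx (projT1 h i).
  have inv2 (x y : 'M[C]_i) : x \in unitmx -> y \in unitmx ->
      x *m y *m (invmx y *m invmx x) = 1%:M.
    by move=> ux uy; rewrite mulmxA mulmxK // mulmxV.
  apply: (can_inj (mulKmx (uk i))); apply: (can_inj (mulKmx (uh i))).
  by rewrite [LHS]mulmxA -comm inv2 // [RHS]mulmxA inv2.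
apply: eq_exist; rewrite /gauge /=; congr Quiver.
- apply: functional_extensionality_dep => i.
  by rewrite !mulmxA comm -!mulmxA commV.
- apply: functional_extensionality_dep => i.
  by rewrite !mulmxA comm -!mulmxA commV.
Qed.

Lemma invariant_kact k (f : inv_ring) : val f \o kact k \in invariant.
Proof.
have /invariantP[rf hf] := valP f.
apply/invariantP; split=> [|h A]; first exact: regular_kact.
by rewrite /= kact_hact hf.
Qed.

Definition pull k (f : inv_ring) : inv_ring :=
  exist (fun f => is_true (f \in invariant)) _ (invariant_kact k f).

Lemma qact_is_point k (chi : qmult) : is_point (val chi \o pull k).
Proof.
have /asboolP[chiL [chi1 chiM]] := valP chi.
apply/asboolP; split=> [c f g|].
  by rewrite /= -chiL; congr (val chi _); apply/val_inj.
split=> [|f g] /=.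
  by rewrite -[RHS]chi1; congr (val chi _); apply/val_inj.
by rewrite -chiM; congr (val chi _); apply/val_inj.
Qed.

(* The action of SU(n) on the quotient: (k . chi)(f) = chi (f(k . -)). *)
Definition qact k (chi : qmult) : qmult :=
  exist (fun chi => is_true (is_point chi)) _ (qact_is_point k chi).

End Variety.

Lemma qclass_kact (C : numClosedFieldType) n (k : SU C n) (A : mult_var C n) :
  qact k (qclass A) = qclass (kact k A).
Proof. exact: val_inj. Qed.

(* theta_j, for 1 <= j <= n *)
Definition coord (R : realType) (n : nat) (theta : 'rV[R]_n) (j : nat) : R :=
  if insub j.-1 is Some i then theta 0 i else 0.

Section Alcove.
Variables (R : realType) (n : nat).
Local Notation C := R[i].

(* The n inequalities of the alcove are 0 <= gap theta j for 1 <= j <= n: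
   theta_{j+1} <= theta_j for j < n, and theta_1 - 2 pi <= theta_n for j = n. *)
Definition gap (theta : 'rV[R]_n) (j : nat) : R :=
  if (j < n)%N then coord theta j - coord theta j.+1
  else coord theta n - (coord theta 1 - 2 * pi).

Definition alcove_pred (theta : 'rV[R]_n) : bool :=
  (\sum_(i < n) theta 0 i == 0) && [forall j : 'I_n, 0 <= gap theta j.+1].

Definition alcove := {theta : 'rV[R]_n | alcove_pred theta}.

HB.instance Definition _ := SubChoice.on alcove.

(* The open face on which the inequalities in S are equalities and the others
   are strict.  The gaps add up to 2 pi, so for 0 < n it is empty exactly when
   S = [set: 'I_n].  The interior of the alcove (in the hyperplane of vectors of
   sum 0) is open_face set0. *)
Definition open_face (S : {set 'I_n}) : set alcove :=
  [set theta | forall j : 'I_n, (gap (val theta) j.+1 == 0) = (j \in S)].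

(* diag(e^{i theta_n}, ..., e^{i theta_1}) *)
Definition torus (theta : alcove) : 'M[C]_n :=
  diag_mx (\row_(a < n) expi (coord (val theta) (n - a))).

Definition centralizer_torus (theta : alcove) : set (SU C n) :=
  [set k : SU C n | val k *m torus theta = torus theta *m val k].

Definition KK (theta : alcove) : set (SU C n) :=
  commutator_subgroup (centralizer_torus theta).

Definition eigen_block (theta : alcove) (z : C) : {set 'I_n} :=
  [set a : 'I_n | torus theta a a == z].

(* SU(n_1) x ... x SU(n_r), one factor on each eigenspace of t(theta); the
   eigenspace for z is spanned by the basis vectors in eigen_block theta z, and
   n_z = #|eigen_block theta z|.  (A block need not be an interval: the first and
   last coordinates have the same eigenvalue when theta_1 - 2 pi = theta_n.) *)
Definition block_SU (theta : alcove) : set (SU C n) :=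
  [set k : SU C n | (forall a b : 'I_n, torus theta a a != torus theta b b ->
              val k a b = 0) /\
           (forall z : C, su_pred
              (\matrix_(a < #|eigen_block theta z|, b < #|eigen_block theta z|)
                 val k (enum_val a) (enum_val b)))].

Definition imp_rel : rel (SU C n * alcove) := fun x y =>
  `[< x.2 = y.2 /\ KK x.2 (x.1^-1 * y.1)%g >].

Lemma imp_rel_refl : reflexive imp_rel.
Proof.
by move=> x; apply/asboolP; rewrite mulVg; case: (commutator_subgroupP
  (centralizer_torus x.2)).
Qed.

Lemma imp_rel_sym : symmetric imp_rel.
Proof.
suff sub x y : imp_rel x y -> imp_rel y x by move=> x y; apply/idP/idP => /sub.
move=> /asboolP[e Kxy]; apply/asboolP; split=> //; rewrite -e.
have [_ _ /(_ _ Kxy)] := commutator_subgroupP (centralizer_torus x.2).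
by rewrite invgM invgK.
Qed.

Lemma imp_rel_trans : transitive imp_rel.
Proof.
move=> y x z /asboolP[e Kxy] /asboolP[e' Kyz]; apply/asboolP.
split; first by rewrite e.
have [_ + _] := commutator_subgroupP (centralizer_torus x.2).
rewrite -e in Kyz.
by move=> /(_ _ _ Kxy Kyz); rewrite mulgA mulgK.
Qed.

Canonical imp_equiv := EquivRel imp_rel imp_rel_refl imp_rel_sym imp_rel_trans.

Definition implosion := {eq_quot imp_rel}.

HB.instance Definition _ := EqQuotient.on implosion.

Definition imp_class (k : SU C n) (theta : alcove) : implosion :=
  \pi_implosion (k, theta).

Definition imp_act (g : SU C n) (x : implosion) : implosion :=
  imp_class (g * (repr x).1)%g (repr x).2.

Lemma imp_classP k theta k' theta' :
  imp_class k theta = imp_class k' theta' <->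
  theta = theta' /\ KK theta (k^-1 * k')%g.
Proof.
rewrite /imp_class; split=> [/eqmodP/asboolP //|h].
by apply/eqmodP/asboolP.
Qed.

Lemma imp_actE g k theta : imp_act g (imp_class k theta) = imp_class (g * k)%g theta.
Proof.
rewrite /imp_act /imp_class.
case: piP => -[k' theta'] /imp_classP[<- Kk].
apply/imp_classP; split=> //=; rewrite invgM mulgA mulgVK.
by have [_ _ /(_ _ Kk)] := commutator_subgroupP (centralizer_torus theta);
  rewrite invgM invgK.
Qed.

Definition imp_stratum (S : {set 'I_n}) : set implosion :=
  [set imp_class x.1 x.2 | x in [set: SU C n] `*` open_face S].

(* The set of all t(theta), theta in the open face S. *)
Definition Yface (S : {set 'I_n}) :=
  {y : 'M[C]_n | `[< exists2 theta, open_face S theta & torus theta = y >]}.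

HB.instance Definition _ (S : {set 'I_n}) := SubChoice.on (Yface S).

(* L = [K_theta0, K_theta0] acts by l . (k, y) = (k l^-1, l y l^-1); this action
   on the second factor is trivial when theta0 is in the open face S. *)
Definition bundle_rel (theta0 : alcove) (S : {set 'I_n}) :
    rel (SU C n * Yface S) := fun x y =>
  `[< exists2 l : SU C n, KK theta0 l &
        y.1 = (x.1 * l^-1)%g /\
        val y.2 = val l *m val x.2 *m invmx (val l) >].

Lemma bundle_rel_refl theta0 S : reflexive (@bundle_rel theta0 S).
Proof.
move=> x; apply/asboolP; exists 1%g.
  by case: (commutator_subgroupP (centralizer_torus theta0)).
by rewrite invg1 mulg1 /= mul1mx invmx1 mulmx1.
Qed.

Lemma bundle_rel_sym theta0 S : symmetric (@bundle_rel theta0 S).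
Proof.
suff sub x y : @bundle_rel theta0 S x y -> bundle_rel theta0 y x.
  by move=> x y; apply/idP/idP => /sub.
move=> /asboolP[l Kl [e1 e2]]; apply/asboolP; exists l^-1%g.
  by case: (commutator_subgroupP (centralizer_torus theta0)) => _ _; apply.
rewrite e1 e2 invgK mulgVK; split=> //=.
by rewrite invmxK !mulmxA mulVmx ?su_unit // mul1mx mulmxKV ?su_unit.
Qed.

Lemma bundle_rel_trans theta0 S : transitive (@bundle_rel theta0 S).
Proof.
move=> y x z /asboolP[l Kl [e1 e2]] /asboolP[m Km [e3 e4]].
apply/asboolP; exists (m * l)%g.
  by case: (commutator_subgroupP (centralizer_torus theta0)) => _ + _; apply.
rewrite e3 e1 e4 e2 invgM mulgA; split=> //=.
rewrite !mulmxA -(mulmxA _ (invmx (sval l))); congr (_ *m _).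
exact: (congr1 val (esym (invgM m l))).
Qed.

Canonical bundle_equiv theta0 S := EquivRel (@bundle_rel theta0 S)
  (@bundle_rel_refl theta0 S) (@bundle_rel_sym theta0 S)
  (@bundle_rel_trans theta0 S).

Definition bundle (theta0 : alcove) (S : {set 'I_n}) :=
  {eq_quot @bundle_rel theta0 S}.

HB.instance Definition _ theta0 S := EqQuotient.on (bundle theta0 S).

Definition bundle_class theta0 S (k : SU C n) (y : Yface S) : bundle theta0 S :=
  \pi_(bundle theta0 S) (k, y).

Definition bundle_act theta0 S (g : SU C n) (x : bundle theta0 S) :=
  bundle_class theta0 (g * (repr x).1)%g (repr x).2.

Lemma bundle_actE theta0 S g k (y : Yface S) :
  bundle_act g (bundle_class theta0 k y) = bundle_class theta0 (g * k)%g y.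
Proof.
rewrite /bundle_act /bundle_class.
case: piP => -[k' y'] /eqmodP/asboolP[l Kl /= [-> e2]].
apply/eqmodP; apply/asboolP; exists l^-1%g.
  by case: (commutator_subgroupP (centralizer_torus theta0)) => _ _; apply.
rewrite /= e2 invgK !mulgA mulgVK; split=> //=.
by rewrite invmxK !mulmxA mulVmx ?su_unit // mul1mx mulmxKV ?su_unit.
Qed.

End Alcove.

(* A continuous branch of the square root on the half-plane Re z < 0, with
   sqrt 0 = 0; its values elsewhere are arbitrary and never used. *)
Record sqrt_branch (R : realType) := SqrtBranch {
  branch :> R[i] -> R[i];
  branch_sqr : forall z, complex.Re z < 0 -> branch z ^+ 2 = z;
  branch_continuous : {in [set z : R[i] | complex.Re z < 0],
                         continuous (branch : R[i]^o -> R[i]^o)};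
  branch0 : branch 0 = 0 }.

Lemma branch_expi (R : realType) (s : sqrt_branch R) (x : R) :
  s (expi x - 1) * s (expi x - 1) = expi x - 1.
Proof.
have [c1|/eqP c1] := eqVneq (cos x) 1.
  suff -> : expi x - 1 = 0 by rewrite branch0 mulr0.
  have /eqP := cos2Dsin2 x; rewrite c1 expr1n -[X in _ == X]addr0.
  rewrite (inj_eq (addrI _)) sqrf_eq0 => /eqP s0.
  by rewrite /expi c1 s0 subrr.
rewrite -expr2 branch_sqr //.
have -> : complex.Re (expi x - 1) = cos x - 1 by [].
by rewrite subr_lt0 lt_neqAle cos_le1 andbT; apply/eqP.
Qed.

Section Toric.
Variables (R : realType) (n : nat) (s : sqrt_branch R).
Local Notation C := R[i].
Implicit Types theta : alcove R n.

Definition qtil theta (m : nat) : C := expi (- coord (val theta) (n - m)).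

Definition qrat theta (m : nat) : C := qtil theta m / qtil theta m.-1.

Definition nu theta (m j : nat) : C :=
  s (\prod_(j <= l < m.+1) qrat theta l - 1).

(* Rows and columns are numbered from 0, hence the shift in nu. *)
Definition toric_quiver theta : quiver C n := Quiver
  (fun m : 'I_n => \matrix_(a < m.+1, b < m)
     if a == b :> nat then nu theta m b.+1 else 0)
  (fun m : 'I_n => \matrix_(a < m, b < m.+1)
     if a == b :> nat then nu theta m a.+1 else 0)
  (fun m : 'I_n => qtil theta m).

Lemma qtil_neq0 theta m : qtil theta m != 0.
Proof. exact: expi_neq0. Qed.

Lemma prod_qrat theta m a : (a <= m)%N ->
  \prod_(a.+1 <= l < m.+1) qrat theta l = qtil theta m / qtil theta a.
Proof.
elim: m => [|m IH].
  by rewrite leqn0 => /eqP ->; rewrite big_geq // divff ?qtil_neq0.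
rewrite leq_eqVlt => /predU1P[->|am].
  by rewrite big_geq // divff ?qtil_neq0.
rewrite big_nat_recr //= IH // /qrat /= mulrC mulrA divfK ?qtil_neq0 //.
Qed.

Lemma nu_sqr theta m a : (a <= m)%N ->
  nu theta m a.+1 * nu theta m a.+1 = qtil theta m / qtil theta a - 1.
Proof.
move=> am; rewrite /nu prod_qrat //.
have -> : qtil theta m / qtil theta a =
    expi (coord (val theta) (n - a) - coord (val theta) (n - m)).
  apply: (canLR (mulfK (qtil_neq0 _ _))).
  by rewrite -expiD addrAC subrr add0r.
exact: branch_expi.
Qed.

Lemma toric_beta_alpha theta (m : 'I_n) :
  1%:M + qbeta (toric_quiver theta) m *m qalpha (toric_quiver theta) m =
  diag_mx (\row_(a < m) (qtil theta m / qtil theta a)).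
Proof.
apply/matrixP => a b; rewrite !mxE.
rewrite (bigD1 (widen_ord (leqnSn m) a)) //= !mxE eqxx big1 ?addr0.
  have [<-|ab] := eqVneq a b.
    by rewrite eqxx nu_sqr ?(ltnW (ltn_ord a)) //= addrC subrK.
  by rewrite (_ : (a == b :> nat) = false) ?mulr0 ?addr0 //; apply/negbTE.
move=> c ca; rewrite !mxE (_ : (a == c :> nat) = false) ?mul0r //.
by rewrite eq_sym; apply/negbTE.
Qed.

Lemma toric_alpha_beta theta (m : 'I_n) :
  1%:M + qalpha (toric_quiver theta) m *m qbeta (toric_quiver theta) m =
  diag_mx (\row_(a < m.+1) (qtil theta m / qtil theta a)).
Proof.
apply/matrixP => a b; rewrite !mxE.
have [am|] := ltnP a m.
  rewrite (bigD1 (Ordinal am)) //= !mxE /= eqxx big1 ?addr0.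
    have [<-|ab] := eqVneq a b.
      by rewrite eqxx nu_sqr ?(ltnW am) //= addrC subrK.
    by rewrite (_ : (a == b :> nat) = false) ?mulr0 ?addr0 //; apply/negbTE.
  move=> c ca; rewrite !mxE (_ : (a == c :> nat) = false) ?mul0r //.
  by rewrite eq_sym; apply/negbTE.
move=> ma; have am : a = m :> nat.
  by apply/eqP; rewrite eqn_leq ma -ltnS ltn_ord.
rewrite big1 ?addr0; last first.
  by move=> c _; rewrite !mxE am gtn_eqF ?mul0r.
by case: eqVneq => _; rewrite am divff ?qtil_neq0.
Qed.

Lemma toric_mult_variety theta : mult_variety (toric_quiver theta).
Proof.
have du p (x : 'rV[C]_p) : (forall a, x 0 a != 0) -> diag_mx x \in unitmx.
  by move=> x0; rewrite unitmxE det_diag unitfE; apply/prodf_neq0 => i _.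
split=> [m|m||m h].
- rewrite toric_alpha_beta toric_beta_alpha; split; apply: du => a;
    by rewrite mxE mulf_neq0 ?invr_eq0 ?qtil_neq0.
- exact: qtil_neq0.
- have expi_sum (I : finType) (F : I -> R) :
      \prod_i expi (F i) = expi (\sum_i F i).
    by elim/big_rec2: _ => [|i x y _ ->]; rewrite ?expi0 ?expiD.
  rewrite /= /qtil expi_sum sumrN.
  suff -> : \sum_(i < n) coord (val theta) (n - i) = 0 by rewrite oppr0 expi0.
  have /andP[/eqP th0 _] := valP theta; rewrite -[RHS]th0.
  rewrite [RHS](reindex_inj rev_ord_inj) /=; apply: eq_bigr => i _.
  rewrite /coord -subnS; case: insubP => [j _ jE|].
    by congr (val theta _ _); apply/val_inj.
  by rewrite -[(n - i.+1)%N]/(val (rev_ord i)) ltn_ord.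
- rewrite toric_alpha_beta toric_beta_alpha; apply/matrixP => a b.
  rewrite !mxE /=; case: eqVneq => //= _; rewrite ?mulr0n ?mulr0 //.
  by rewrite !mulr1n mulrCA.
Qed.

Definition toric_point theta : mult_var C n :=
  exist _ _ (toric_mult_variety theta).

(* k . [A(theta)] *)
Definition orbit_point (k : SU C n) theta : qmult C n :=
  qact k (qclass (toric_point theta)).

Definition sweep (F : set (alcove R n)) : set (qmult C n) :=
  [set orbit_point x.1 x.2 | x in [set: SU C n] `*` F].

End Toric.

(* Main.v *)
Require Import Defs.
From HB Require Import structures.
From mathcomp Require Import all_boot all_order all_algebra.
From mathcomp Require Import all_classical all_reals all_analysis.
From mathcomp Require Import complex perm ring lra zify.

Set Implicit Arguments.
Unset Strict Implicit.
Unset Printing Implicit Defensive.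

Import Order.TTheory GRing.Theory Num.Theory.

Local Open Scope ring_scope.

(** A point of the GIT quotient is known through the values of the invariant
    functions, so the theorem amounts to two facts: theta can be read off from
    invariants of k . [A(theta)], and the stabilizer of [A(theta)] in SU(n) is
    [K_theta, K_theta].

    The scalars of the quiver are invariant and give t(theta).  Two points of
    the alcove with the same t(theta) have coordinates differing by d_1, ...,
    d_n with sum 0 and |d_i - d_j| <= 2 pi; since n d_i is the sum of the
    d_i - d_j, this forces |d_i| < 2 pi, hence d_i = 0 (torus_inj).

    The stabilizer contains [K_theta, K_theta].  For k block-diagonal along the
    eigenspaces of t(theta), let its m-th corner act on C^m as k on the blocks
    that lie inside the first m coordinates, and as 1 on the other blocks.
    Corners are multiplicative, so the corner of a commutator has determinant 1
    and the corners form an element of H_C.  Consecutive corners differ only on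
    the block of the last index, which is where the diagonal maps of A(theta)
    vanish; so k followed by the corners fixes A(theta) (diag_quiver_stab,
    KK_stab).

    The stabilizer is contained in [K_theta, K_theta].  The invariant matrix
    alpha_{n-1} beta_{n-1} is a multiple of t(theta) plus a scalar matrix, hence
    a stabilizing k commutes with t(theta) (stab_centralizer).  If the
    coordinates p, ..., p+q-1 form a union of blocks, consider the (q+p) x (q+p)
    determinant whose rows are the composite of the maps beta from C^(q+p) down
    to C^p and the rows p, ..., p+q-1 of the composite of the maps alpha from
    C^(q+p) up to C^n.  It is invariant under H_C, does not vanish at A(theta),
    and k multiplies it by the determinant of its block on these coordinates
    (interval_inv_hact, interval_inv_kact, interval_inv_toric); so this
    determinant is 1.  The set of indices of an eigenvalue is an interval, or
    the complement of one when the block wraps around the circle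
    (expi_level_interval); in the second case det k = 1 settles the matter.

    That the block-diagonal special unitary matrices with all block determinants
    1 are exactly [K_theta, K_theta] comes from the spectral theorem: a unitary
    diagonal matrix of determinant 1 is the commutator of a diagonal matrix and
    a cyclic permutation (unitary_commutator, block_commutator).

    As for the faces, whether two eigenvalues of t(theta) agree depends only on
    which of the n gaps of theta vanish, because the gaps are nonnegative of
    sum 2 pi (torus_diag_eq); hence K_theta is constant on open faces.  On an
    open face reduced to a point at most one gap is nonzero, as two nonzero gaps
    could be varied against each other (shift_gap); then t(theta) is scalar and
    all of SU(n) fixes [A(theta)]. *)

(** * Block determinants *)

(** Both sides are the determinant of the block matrix with diagonal blocks 1
    and off-diagonal blocks - A and B, by its two triangular factorizations. *)
Lemma det_1D_mulC (F : comNzRingType) m n (A : 'M[F]_(m, n)) (B : 'M[F]_(n, m)) :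
  \det (1%:M + A *m B) = \det (1%:M + B *m A).
Proof.
have <- : \det (block_mx 1%:M (- A) B 1%:M) = \det (1%:M + A *m B).
  have -> : block_mx 1%:M (- A) B 1%:M =
      block_mx (1%:M + A *m B) (- A) 0 1%:M *m block_mx 1%:M 0 B 1%:M.
    rewrite mulmx_block !mulmx1 ?mul1mx ?mul0mx ?mulmx0 mulNmx addrK.
    by rewrite !add0r.
  by rewrite det_mulmx det_ublock det_lblock !det1 !mulr1.
have -> : block_mx 1%:M (- A) B 1%:M =
    block_mx 1%:M 0 B 1%:M *m block_mx 1%:M (- A) 0 (1%:M + B *m A).
  rewrite mulmx_block !mulmx1 ?mul1mx ?mul0mx ?mulmx0 !addr0 mulmxN.
  by rewrite addrCA addNr addr0.
by rewrite det_mulmx det_lblock det_ublock !det1 !mul1r.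
Qed.

Definition ord_interval n (p m : nat) : {set 'I_n} :=
  [set a : 'I_n | (p <= a < m)%N].

Section Selection.
Variables (C : comNzRingType) (n : nat).
Implicit Types (S T : {set 'I_n}) (k l : 'M[C]_n).

Definition coord_sel S : 'M[C]_(#|S|, n) := \matrix_(i, j) (enum_val i == j)%:R.

Definition coord_proj S : 'M[C]_n := diag_mx (\row_a (a \in S)%:R).

(** When l preserves the coordinate subspace of S, this is the determinant of
    the block of l on S (see det_submx_block_det); keeping it as an n x n
    determinant avoids reindexing S. *)
Definition block_det S l : C := \det (1%:M + (l - 1%:M) *m coord_proj S).

Lemma coord_sel_mul S T :
  coord_sel S *m (coord_sel T)^T =
  \matrix_(i, j) (enum_val i == enum_val j)%:R.
Proof.
apply/matrixP => i j; rewrite !mxE (bigD1 (enum_val i)) //= !mxE eqxx mul1r.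
rewrite big1 ?addr0 => [|c ci]; first by rewrite eq_sym.
by rewrite !mxE eq_sym (negbTE ci) mul0r.
Qed.

Lemma coord_selK S : coord_sel S *m (coord_sel S)^T = 1%:M.
Proof.
rewrite coord_sel_mul; apply/matrixP => i j.
by rewrite !mxE (inj_eq enum_val_inj).
Qed.

Lemma coord_sel_disjoint S T : [disjoint S & T] ->
  coord_sel S *m (coord_sel T)^T = 0.
Proof.
move=> dST; rewrite coord_sel_mul; apply/matrixP => i j; rewrite !mxE.
case: eqP => // e; have := enum_valP j; rewrite -e.
by move/(disjointFr dST): (enum_valP i) => ->.
Qed.

Lemma coord_sel_proj S : (coord_sel S)^T *m coord_sel S = coord_proj S.
Proof.
apply/matrixP => a b; rewrite !mxE.
have [aS|aS] := boolP (a \in S); last first.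
  rewrite big1 ?mul0rn // => i _; rewrite !mxE.
  case: eqP => [e|]; rewrite ?mul0r //.
  by rewrite -e enum_valP in aS.
rewrite (bigD1 (enum_rank_in aS a)) //= !mxE enum_rankK_in // eqxx mul1r.
rewrite big1 ?addr0 // => i ia; rewrite !mxE.
case: eqP => [e|]; rewrite ?mul0r //.
by case/eqP: ia; apply: enum_val_inj; rewrite e enum_rankK_in.
Qed.

Lemma coord_sel_submx S l :
  coord_sel S *m l *m (coord_sel S)^T =
  \matrix_(i, j) l (enum_val i) (enum_val j).
Proof.
apply/matrixP => i j; rewrite !mxE (bigD1 (enum_val j)) //= big1 ?addr0; last first.
  by move=> c cj; rewrite !mxE eq_sym (negbTE cj) mulr0.
rewrite !mxE eqxx mulr1 (bigD1 (enum_val i)) //= big1 ?addr0 ?mxE ?eqxx ?mul1r //.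
by move=> c ci; rewrite !mxE eq_sym (negbTE ci) mul0r.
Qed.

Lemma det_submx_block_det S l :
  \det (\matrix_(i, j) l (enum_val i) (enum_val j) : 'M[C]_#|S|) = block_det S l.
Proof.
rewrite /block_det -coord_sel_proj -coord_sel_submx mulmxA det_1D_mulC.
congr (\det _); rewrite mulmxA mulmxBr mulmxBl mulmx1 coord_selK.
by rewrite addrC subrK.
Qed.

Lemma coord_projE S l a b : (l *m coord_proj S) a b = l a b *+ (b \in S).
Proof. by rewrite mul_mx_diag !mxE mulr_natr. Qed.

Lemma coord_projEl S l a b : (coord_proj S *m l) a b = l a b *+ (a \in S).
Proof. by rewrite mul_diag_mx !mxE mulr_natl. Qed.

Lemma coord_projK S : coord_proj S *m coord_proj S = coord_proj S.
Proof.
by rewrite -{1}coord_sel_proj -[X in _ *m X]coord_sel_proj -mulmxA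
  [coord_sel S *m _]mulmxA coord_selK mul1mx coord_sel_proj.
Qed.

Lemma coord_projC S : coord_proj (~: S) = 1%:M - coord_proj S.
Proof.
apply/matrixP => a b; rewrite !mxE inE.
by case: (a \in S); case: (a == b); rewrite ?(subrr, subr0, mulr0n, mulr1n).
Qed.

(** With P the projection on S and x = l - 1, (1 + x P)(1 + x (1 - P)) = 1 + x
    because P commutes with x and P (1 - P) = 0. *)
Lemma block_det_setC S l : l *m coord_proj S = coord_proj S *m l ->
  \det l = block_det S l * block_det (~: S) l.
Proof.
move=> lS; rewrite /block_det -det_mulmx; congr (\det _).
rewrite coord_projC; set P := coord_proj S in lS *; set x := l - 1%:M.
have xP : x *m P = P *m x by rewrite mulmxBl mulmxBr lS mul1mx mulmx1.
have xPy (y : 'M[C]_n) : x *m P *m (x *m (y - P *m y)) = 0.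
  rewrite mulmxA -(mulmxA x P x) -xP -!mulmxA mulmxBr [P *m (P *m y)]mulmxA.
  by rewrite coord_projK subrr !mulmx0.
have := xPy 1%:M; rewrite mulmx1 => {}xPy.
rewrite mulmxDl mul1mx (mulmxDr (x *m P)) xPy mulmx1 addr0 mulmxBr mulmx1.
by rewrite -addrA subrK addrC subrK.
Qed.

Lemma block_detE S k :
  \det (1%:M + (k - 1%:M) *m coord_proj S) = block_det S k.
Proof. by []. Qed.

Lemma block_det0 k : block_det finset.set0 k = 1.
Proof.
rewrite /block_det (_ : coord_proj finset.set0 = 0) ?mulmx0 ?addr0 ?det1 //.
by apply/matrixP => a b; rewrite !mxE inE mul0rn.
Qed.

Lemma block_detT k : block_det (finset.setTfor 'I_n) k = \det k.
Proof.
rewrite /block_det (_ : coord_proj (finset.setTfor 'I_n) = 1%:M).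
  by rewrite mulmx1 addrC subrK.
by apply/matrixP => a b; rewrite !mxE inE.
Qed.

Lemma block_det1 S : block_det S (1%:M : 'M[C]_n) = 1.
Proof. by rewrite /block_det subrr mul0mx addr0 det1. Qed.

Lemma block_detM S k l : l *m coord_proj S = coord_proj S *m l ->
  block_det S (k *m l) = block_det S k * block_det S l.
Proof.
move=> lS; rewrite /block_det -det_mulmx; congr (\det _).
set P := coord_proj S in lS *.
have PlP : P *m ((l - 1%:M) *m P) = (l - 1%:M) *m P.
  by rewrite mulmxA mulmxBr -lS mulmx1 mulmxBl -mulmxA coord_projK mulmxBl mul1mx.
rewrite [RHS]mulmxDl mul1mx [in X in _ = _ + X]mulmxDr mulmx1.
rewrite -(mulmxA _ P) PlP mulmxA -addrA -!mulmxDl; congr (_ + _ *m _).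
rewrite mulmxBr mulmx1 mulmxBl mul1mx.
by rewrite [X in _ = _ + X]addrC subrK [RHS]addrC addrA subrK.
Qed.

End Selection.

(** * Unitary matrices of determinant 1 are commutators *)

Section UnitaryCommutators.
Variables (C : numClosedFieldType) (m : nat).
Local Open Scope sesquilinear_scope.

Lemma unitary_diag_mx (d : 'rV[C]_m) :
  (diag_mx d \is unitarymx) = [forall i, d 0 i * (d 0 i)^* == 1].
Proof.
apply/unitarymxP/forallP => [h i|h].
  move/matrixP/(_ i i): h; rewrite tr_diag_mx map_diag_mx mul_diag_mx !mxE eqxx.
  by move=> /eqP.
rewrite tr_diag_mx map_diag_mx mulmx_diag -diag_const_mx; congr diag_mx.
by apply/rowP => i; rewrite !mxE (eqP (h i)).
Qed.

Lemma unitary_perm_mx (s : 'S_m) :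
  perm_mx s \is @unitarymx C m m.
Proof.
apply/unitarymxP; rewrite tr_perm_mx.
rewrite [map_mx _ _]map_perm_mx -perm_mxM mulgV.
exact: perm_mx1.
Qed.

(** Take for y the cyclic permutation and for x the diagonal matrix of the
    products of the final segments of d: the commutator has the ratios of
    consecutive products on its diagonal, and the condition on the product of d
    closes the cycle. *)
Lemma diag_commutator (d : 'rV[C]_m) :
  diag_mx d \is unitarymx -> \prod_i d 0 i = 1 ->
  exists x y : 'M[C]_m, [/\ x \is unitarymx, y \is unitarymx &
    y *m x *m diag_mx d = x *m y].
Proof.
rewrite unitary_diag_mx => /forallP du d1.
pose e : 'rV[C]_m := \row_(i < m) \prod_(j < m | (i < j)%N) d 0 j.
exists (diag_mx e), (perm_mx (perm (@ordS_inj m))); split.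
- rewrite unitary_diag_mx; apply/forallP => i; rewrite !mxE rmorph_prod -big_split.
  by apply/eqP; rewrite big1 // => j _; apply/eqP/du.
- exact: unitary_perm_mx.
rewrite -mulmxA mulmx_diag -row_permE; apply/matrixP => i j.
rewrite mul_diag_mx !mxE permE.
have [_|] := eqVneq (ordS i) j; last by rewrite !mulr0n mulr0.
rewrite mulr1n mulr1; have [im|im] := ltnP i.+1 m.
  rewrite [RHS](bigD1 (ordS i)) /= ?modn_small // mulrC; congr (_ * _).
  apply: eq_bigl => l; rewrite -(inj_eq val_inj) /= modn_small //.
  by rewrite [(i.+1 < l)%N]ltn_neqAle eq_sym andbC.
have im' : i.+1 = m by apply/eqP; rewrite eqn_leq im ltn_ord.
rewrite [RHS]big1 => [|l il]; last first.
  by have := leq_trans (ltn_ord l) im; rewrite ltnS leqNgt il.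
rewrite -[RHS]d1 [RHS](bigD1 (ordS i)) //= mulrC; congr (_ * _).
apply: eq_bigl => l; rewrite -(inj_eq val_inj) /= im' modnn.
by rewrite lt0n.
Qed.

(** The spectral theorem reduces the claim to diagonal matrices.  The
    conclusion is the commutator equation k = x^-1 y^-1 x y without inverses. *)
Lemma unitary_commutator (k : 'M[C]_m) :
  k \is unitarymx -> \det k = 1 ->
  exists x y : 'M[C]_m, [/\ x \is unitarymx, y \is unitarymx &
    y *m x *m k = x *m y].
Proof.
move=> ku k1.
have /orthomx_spectralP : k \is normalmx.
  apply/normalmxP; rewrite (unitarymxP ku).
  by move: ku; rewrite -trmxC_unitary => /unitarymxP; rewrite trmxCK.
set u := spectralmx k; set d := spectral_diag k => kE.
have uu : u \is unitarymx := spectral_unitarymx k.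
have uU := unitarymx_unit uu.
have vu : invmx u \is unitarymx by rewrite invmx_unitary ?trmxC_unitary.
have dE : diag_mx d = u *m k *m invmx u.
  by rewrite kE !mulmxA mulmxV // mul1mx mulmxK.
have [||x [y [xu yu xy]]] := @diag_commutator d.
- by rewrite dE !mul_unitarymx.
- by rewrite -det_diag dE !det_mulmx mulrAC -det_mulmx mulmxV // det1 mul1r.
exists (invmx u *m x *m u), (invmx u *m y *m u); split.
- by rewrite !mul_unitarymx.
- by rewrite !mul_unitarymx.
rewrite kE !mulmxA mulmxK // mulmxK // mulmxK //.
by rewrite -!mulmxA; congr (_ *m _); rewrite !mulmxA xy.
Qed.

End UnitaryCommutators.

(** * Block-diagonal matrices *)

(** t colors the coordinates; the blocks are the color classes, which need not
    be intervals. *)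
Definition block_diag (C : pzRingType) (T : eqType) n (t : 'I_n -> T)
    (k : 'M[C]_n) : Prop :=
  forall a b, t a != t b -> k a b = 0.

Definition color_class (T : eqType) n (t : 'I_n -> T) (z : T) : {set 'I_n} :=
  [set a | t a == z].

Lemma color_class_disjoint (T : eqType) n (t : 'I_n -> T) z w :
  z != w -> [disjoint color_class t z & color_class t w].
Proof.
move=> /negP zw; apply/pred0P => a /=; rewrite !inE.
by apply/negP => /andP[/eqP az aw]; case: zw; rewrite -az.
Qed.

Lemma block_diag_proj (C : comNzRingType) (T : eqType) n (t : 'I_n -> T)
    (k : 'M[C]_n) :
  block_diag t k <->
  forall z, k *m coord_proj C (color_class t z) =
            coord_proj C (color_class t z) *m k.
Proof.
split=> [kt z|kt a b ab].
  apply/matrixP => a b; rewrite coord_projE coord_projEl !inE.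
  have [<-|/kt ->] := eqVneq (t a) (t b); last by rewrite !mul0rn.
  by [].
have /matrixP/(_ a b) := kt (t a).
rewrite coord_projE coord_projEl !inE eqxx [t b == _]eq_sym (negbTE ab).
by rewrite mulr0n mulr1n.
Qed.

Section UnitaryBlocks.
Local Open Scope sesquilinear_scope.

Lemma coord_selC (C : numClosedFieldType) n (S : {set 'I_n}) :
  (coord_sel C S)^t* = (coord_sel C S)^T.
Proof. by apply/matrixP => i j; rewrite !mxE conjC_nat. Qed.

Lemma unitary_submx (C : numClosedFieldType) n (S : {set 'I_n}) (k : 'M[C]_n) :
  k \is unitarymx -> k *m coord_proj C S = coord_proj C S *m k ->
  coord_sel C S *m k *m (coord_sel C S)^T \is unitarymx.
Proof.
move=> ku kS; apply/unitarymxP.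
rewrite !trmx_mul !map_mxM /= -[in X in _ *m X]coord_selC trmxCK coord_selC.
rewrite !mulmxA -(mulmxA _ (coord_sel C S)^T) coord_sel_proj.
rewrite -(mulmxA _ k) kS !mulmxA -[in X in X *m k]coord_sel_proj mulmxA.
rewrite coord_selK mul1mx -(mulmxA _ k) (unitarymxP ku) mulmx1.
by rewrite coord_selC coord_selK.
Qed.

(** Scalars do not affect commutators, so they can be used to move a commutator
    of unitary matrices into SU(n). *)
Lemma unitary_rescale (C : numClosedFieldType) n (x : 'M[C]_n) : (0 < n)%N ->
  x \is unitarymx -> exists c : C, su_pred (c *: x).
Proof.
move=> n0 xu; pose c : C := n.-root (\det x)^-1.
have cn : c ^+ n * \det x = 1.
  by rewrite rootCK // mulVf // -unitfE -unitmxE unitarymx_unit.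
have dx : `|\det x| = 1.
  move/unitarymxP/(congr1 determinant): xu; rewrite det_mulmx det1.
  rewrite det_map_mx det_tr -normCK => /eqP.
  by rewrite sqrp_eq1 ?normr_ge0 // => /eqP.
have c1 : `|c| = 1 by rewrite norm_rootC normfV dx invr1 rootC1.
exists c.
rewrite /su_pred detZ cn eqxx andbT; apply/unitarymxP.
rewrite linearZ /= map_mxZ -scalemxAl -scalemxAr scalerA (unitarymxP xu).
by rewrite -normCK c1 expr1n scale1r.
Qed.

End UnitaryBlocks.

Section Assembly.
Variables (C : numClosedFieldType) (T : eqType) (n : nat) (t : 'I_n -> T).
Local Open Scope sesquilinear_scope.
Local Notation blk := (color_class t).
Local Notation sel z := (coord_sel C (blk z)).

Definition colors : seq T := undup [seq t a | a <- enum 'I_n].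

Lemma mem_colors a : t a \in colors.
Proof. by rewrite mem_undup map_f ?mem_enum. Qed.

Definition assemble (x : forall z, 'M[C]_#|blk z|) : 'M[C]_n :=
  \sum_(z <- colors) (sel z)^T *m x z *m sel z.

Lemma assembleM x y :
  assemble x *m assemble y = assemble (fun z => x z *m y z).
Proof.
rewrite /assemble mulmx_suml [LHS]big_seq_cond [RHS]big_seq_cond.
apply: eq_bigr => z /andP[zc _]; rewrite mulmx_sumr.
rewrite (bigD1_seq z) ?undup_uniq //= big1_seq => [|w /andP[wz _]].
  by rewrite addr0 !mulmxA -(mulmxA _ (sel z)) coord_selK mulmx1.
rewrite !mulmxA -(mulmxA _ (sel z)) coord_sel_disjoint ?mulmx0 ?mul0mx //.
by rewrite color_class_disjoint // eq_sym.
Qed.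

Lemma assembleC x : (assemble x)^t* = assemble (fun z => (x z)^t*).
Proof.
rewrite /assemble linear_sum raddf_sum; apply: eq_bigr => z _ /=.
rewrite !trmx_mul !map_mxM /= coord_selC -[in X in _ *m X]coord_selC trmxCK.
by rewrite mulmxA.
Qed.

Lemma assemble_block_diag x : block_diag t (assemble x).
Proof.
move=> a b ab; rewrite /assemble summxE big1 // => z _.
have selP : sel z = sel z *m coord_proj C (blk z).
  by rewrite -coord_sel_proj mulmxA coord_selK mul1mx.
rewrite {2}selP mulmxA coord_projE inE.
have [tb|] := eqVneq (t b) z; last by rewrite mulr0n.
have -> : (sel z)^T = coord_proj C (blk z) *m (sel z)^T.
  by rewrite -coord_sel_proj -mulmxA coord_selK mulmx1.
by rewrite -!mulmxA coord_projEl inE -tb (negbTE ab) mulr0n mul0rn.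
Qed.

Lemma assembleK k : block_diag t k ->
  assemble (fun z => sel z *m k *m (sel z)^T) = k.
Proof.
move=> kt; apply/matrixP => a b; rewrite /assemble summxE.
rewrite (eq_bigr (fun z => k a b *+ (a \in blk z) *+ (b \in blk z))).
  rewrite (bigD1_seq (t a)) ?undup_uniq ?mem_colors //= big1 => [|w wa].
    rewrite addr0 !inE eqxx; have [_|ba] := eqVneq (t b) (t a) => //.
    by rewrite kt // eq_sym.
  by rewrite !inE [t a == w]eq_sym (negbTE wa) mulr0n mul0rn.
move=> z _; rewrite !mulmxA -(mulmxA _ (sel z)^T) coord_sel_proj.
by rewrite coord_projE coord_projEl.
Qed.

Lemma assemble1 : assemble (fun z => 1%:M) = 1%:M.
Proof.
rewrite -[RHS]assembleK => [|a b ab].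
  by apply: eq_bigr => z _; rewrite !mulmx1 coord_selK mulmx1.
by rewrite mxE; have [e|] := eqVneq a b; rewrite ?mulr0n // e eqxx in ab *.
Qed.

Lemma assemble_unitary x :
  (forall z, x z \is unitarymx) -> assemble x \is unitarymx.
Proof.
move=> xu; apply/unitarymxP; rewrite assembleC assembleM -assemble1.
by apply: eq_bigr => z _; rewrite (unitarymxP (xu z)).
Qed.

(** Each block is a commutator by unitary_commutator, and assembling the
    factors is compatible with products. *)
Lemma block_commutator k : k \is unitarymx -> block_diag t k ->
    (forall z, block_det (blk z) k = 1) ->
  exists x y : 'M[C]_n, [/\ x \is unitarymx /\ block_diag t x,
    y \is unitarymx /\ block_diag t y & y *m x *m k = x *m y].
Proof.
move=> ku kt k1; pose kz z := sel z *m k *m (sel z)^T.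
have kzu z : kz z \is unitarymx.
  exact/unitary_submx/(block_diag_proj t k).1.
have kz1 z : \det (kz z) = 1.
  by rewrite /kz coord_sel_submx det_submx_block_det.
have ex z := cid (unitary_commutator (kzu z) (kz1 z)).
have ey z := cid (projT2 (ex z)).
exists (assemble (fun z => projT1 (ex z))), (assemble (fun z => projT1 (ey z))).
split.
- split; last exact: assemble_block_diag.
  by apply: assemble_unitary => z; case: (projT2 (ey z)).
- split; last exact: assemble_block_diag.
  by apply: assemble_unitary => z; case: (projT2 (ey z)).
rewrite -{1}(assembleK kt) !assembleM; apply: eq_bigr => z _.
by case: (projT2 (ey z)) => _ _ ->.
Qed.

End Assembly.

(** * The derived group of a centralizer *)

Local Open Scope classical_set_scope.
Local Open Scope ring_scope.

Lemma subgroup_commg (G : groupType) (H : set G) x y :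
  is_subgroup H -> H x -> H y -> H (commg x y).
Proof.
move=> [_ HM HV] Hx Hy; rewrite /commg /conjg.
by apply: (HM _ _ (HV _ Hx)); apply: (HM _ _ (HV _ Hy)); exact: HM.
Qed.

Lemma val_su1 (C : numClosedFieldType) n : val (1%g : SU C n) = 1%:M.
Proof. by []. Qed.

Lemma val_suM (C : numClosedFieldType) n (k l : SU C n) :
  val (k * l)%g = val k *m val l.
Proof. by []. Qed.

Lemma val_suV (C : numClosedFieldType) n (k : SU C n) :
  val (k^-1)%g = invmx (val k).
Proof. by []. Qed.

Section BlockSubgroups.
Variables (C : numClosedFieldType) (T : eqType) (n : nat) (t : 'I_n -> T).
Implicit Types k l : SU C n.

Definition block_centralizer : set (SU C n) := [set k | block_diag t (val k)].

Definition block_special : set (SU C n) :=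
  [set k | block_diag t (val k) /\
           forall z, block_det (color_class t z) (val k) = 1].

Lemma block_centralizer_subgroup : is_subgroup block_centralizer.
Proof.
rewrite /block_centralizer.
split=> [|x y|x] /=; rewrite ?val_su1 ?val_suM ?val_suV.
- by apply/block_diag_proj => z; rewrite mul1mx mulmx1.
- move=> /block_diag_proj hx /block_diag_proj hy; apply/block_diag_proj => z.
  by rewrite -mulmxA hy mulmxA hx mulmxA.
- move=> /block_diag_proj hx; apply/block_diag_proj => z.
  apply: (can_inj (mulKmx (su_unit x))); rewrite !mulmxA hx.
  by rewrite mulmxV ?su_unit // mul1mx -mulmxA mulmxV ?su_unit // mulmx1.
Qed.

Lemma block_centralizer_detM k l z : block_centralizer l ->
  block_det (color_class t z) (val (k * l)%g) =
  block_det (color_class t z) (val k) * block_det (color_class t z) (val l).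
Proof.
by move=> /block_diag_proj Kl; rewrite val_suM block_detM.
Qed.

Lemma block_special_subgroup : is_subgroup block_special.
Proof.
have [K1 KM KV] := block_centralizer_subgroup.
split=> [|x y [Kx x1] [Ky y1]|x [Kx x1]]; split=> [|z].
- exact: K1.
- by rewrite val_su1 block_det1.
- exact: KM.
- by rewrite block_centralizer_detM // x1 y1 mulr1.
- exact: KV.
- have := block_centralizer_detM x^-1%g z Kx.
  by rewrite mulVg val_su1 block_det1 x1 mulr1.
Qed.

(** Block determinants are multiplicative on block-diagonal matrices, with
    values in a commutative group. *)
Lemma commg_block_special k l :
  block_centralizer k -> block_centralizer l -> block_special (commg k l).
Proof.
have KS := block_centralizer_subgroup; have [K1 KM KV] := KS => Kk Kl.
have Kc := subgroup_commg KS Kk Kl; split=> // z.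
pose d (x : SU C n) := block_det (color_class t z) (val x).
have dM x y : block_centralizer y -> d (x * y)%g = d x * d y.
  exact: block_centralizer_detM.
have dU x : block_centralizer x -> d x != 0.
  move=> Kx; have : d (x^-1 * x)%g = 1 by rewrite mulVg /d val_su1 block_det1.
  rewrite dM // => dx1; apply/eqP => dx0; move/eqP: dx1.
  by rewrite dx0 mulr0 eq_sym oner_eq0.
apply: (mulfI (mulf_neq0 (dU _ Kl) (dU _ Kk))).
rewrite -/(d (commg k l)) -dM // -dM; last exact: Kc.
by rewrite -commgC mulr1 !dM // mulrC.
Qed.

Lemma block_special_commg k : (0 < n)%N -> block_special k ->
  exists x y, [/\ block_centralizer x, block_centralizer y & k = commg x y].
Proof.
move=> n0 [kt k1]; have /andP[ku _] := valP k.
have [x [y [[xu xt] [yu yt] xy]]] := block_commutator ku kt k1.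
have [c sx] := unitary_rescale n0 xu; have [d sy] := unitary_rescale n0 yu.
pose X : SU C n := exist (fun z : 'M[C]_n => is_true (su_pred z)) _ sx.
pose Y : SU C n := exist (fun z : 'M[C]_n => is_true (su_pred z)) _ sy.
have blockZ e z : block_diag t z -> block_diag t (e *: z : 'M[C]_n).
  by move=> zt a b ab; rewrite mxE zt ?mulr0.
exists X, Y; split; [exact: blockZ..|].
apply: (@mulgI _ (Y * X)%g); rewrite -commgC; apply/val_inj.
rewrite !val_suM /=.
by rewrite -!scalemxAl -!scalemxAr -!scalemxAl !scalerA xy mulrC.
Qed.

Lemma commutator_block_centralizer : (0 < n)%N ->
  commutator_subgroup block_centralizer = block_special.
Proof.
move=> n0; apply/seteqP; split=> [|k /(block_special_commg n0)[x [y [Kx Ky ->]]]].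
  apply: smallest_sub; first exact: block_special_subgroup.
  by move=> _ [x Kx [y Ky <-]]; exact: commg_block_special.
by apply: sub_gen_smallest; exists x => //; exists y.
Qed.

End BlockSubgroups.

Section TorusCentralizer.
Variables (R : realType) (n : nat).
Implicit Types (theta : alcove R n) (k : SU R[i] n).

(** The coloring of the coordinates by the eigenvalues of t(theta). *)
Definition torus_diag theta : 'I_n -> R[i] := fun a => torus theta a a.

Lemma centralizer_torusE theta :
  centralizer_torus theta = block_centralizer (torus_diag theta).
Proof.
have eq_entries k a b :
    ((val k *m torus theta) a b = (torus theta *m val k) a b) <->
    (torus_diag theta a != torus_diag theta b -> val k a b = 0).
  rewrite mul_mx_diag mul_diag_mx /torus_diag !mxE !eqxx !mulr1n.
  rewrite [X in X = _]mulrC; set u := expi _; set v := expi _.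
  split=> [/eqP|h]; last by have [->//|/h ->] := eqVneq v u; rewrite !mulr0.
  by rewrite -subr_eq0 -mulrBl mulf_eq0 subr_eq0 => /orP[/eqP ->|/eqP//];
    rewrite eqxx.
apply/seteqP; split=> k; rewrite /centralizer_torus /block_centralizer /=.
  by move=> /matrixP h a b; apply/eq_entries.
by move=> h; apply/matrixP => a b; apply/eq_entries/h.
Qed.

Lemma block_SUE theta : block_SU theta = block_special (torus_diag theta).
Proof.
apply/seteqP; split=> k [kt k1]; split=> // z.
  by rewrite -det_submx_block_det; have /andP[_ /eqP] := k1 z.
have /andP[ku _] := valP k.
rewrite /su_pred det_submx_block_det k1 eqxx andbT.
rewrite -coord_sel_submx; apply: unitary_submx => //.
exact: (block_diag_proj _ _).1.
Qed.

Lemma KK_E theta : (0 < n)%N -> KK theta = block_special (torus_diag theta).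
Proof.
by move=> n0; rewrite /KK centralizer_torusE commutator_block_centralizer.
Qed.

Lemma KK_centralizer theta : KK theta `<=` centralizer_torus theta.
Proof.
have KS := block_centralizer_subgroup R[i] (torus_diag theta).
rewrite /KK centralizer_torusE; apply: smallest_sub.
  exact: KS.
by move=> _ [x Kx [y Ky <-]]; exact: (subgroup_commg KS Kx Ky).
Qed.

End TorusCentralizer.

(** * The action on the quotient and the stabilizers of diagonal quivers *)

Lemma invmxM (F : comUnitRingType) m (x y : 'M[F]_m) :
  x \in unitmx -> y \in unitmx -> invmx (x *m y) = invmx y *m invmx x.
Proof.
move=> ux uy; have uxy : x *m y \in unitmx by rewrite unitmx_mul ux.
apply: (can_inj (mulKmx uxy)).
by rewrite mulmxV // mulmxA mulmxK // mulmxV.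
Qed.

Section Action.
Variables (C : numClosedFieldType) (n : nat).
Implicit Types (k l : SU C n) (A : mult_var C n).

Lemma gauge_gauge (g h : forall i : nat, 'M[C]_i) (A : quiver C n) :
  (forall i, g i \in unitmx) -> (forall i, h i \in unitmx) ->
  gauge g (gauge h A) = gauge (fun i => g i *m h i) A.
Proof.
move=> ug uh; rewrite /gauge /=; congr Quiver;
  apply: functional_extensionality_dep => i;
  by rewrite invmxM // !mulmxA.
Qed.

Lemma gauge_fix (g : forall i : nat, 'M[C]_i) (A : quiver C n) :
  (forall i, g i \in unitmx) ->
  (forall i : 'I_n, g i.+1 *m qalpha A i = qalpha A i *m g i) ->
  (forall i : 'I_n, g i *m qbeta A i = qbeta A i *m g i.+1) ->
  gauge g A = A.
Proof.
case: A => a b q ug /= ga gb; rewrite /gauge /=; congr Quiver;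
  apply: functional_extensionality_dep => i.
  by rewrite ga mulmxK.
by rewrite gb mulmxK.
Qed.

Lemma eq_gauge (g h : forall i : nat, 'M[C]_i) (A : quiver C n) :
  (forall i, (i <= n)%N -> g i = h i) -> gauge g A = gauge h A.
Proof.
move=> gh; rewrite /gauge; congr Quiver;
  apply: functional_extensionality_dep => i;
  by rewrite (gh i) ?(ltnW (ltn_ord i)) // (gh i.+1).
Qed.

Lemma at_top1 i : at_top (1%:M : 'M[C]_n) i = 1%:M.
Proof.
rewrite /at_top; have [->|ni] := eqVneq i n; first by rewrite conform_mx_id.
by rewrite nonconform_mx // eq_sym ni.
Qed.

Lemma at_topM (x y : 'M[C]_n) i : at_top x i *m at_top y i = at_top (x *m y) i.
Proof.
rewrite /at_top; have [->|ni] := eqVneq i n; first by rewrite !conform_mx_id.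
by rewrite !nonconform_mx ?mulmx1 // eq_sym ni.
Qed.

Lemma at_top_neq (x : 'M[C]_n) i : i != n -> at_top x i = 1%:M.
Proof. by move=> ni; rewrite /at_top nonconform_mx // eq_sym ni. Qed.

Lemma kact1 A : kact 1%g A = A.
Proof.
case: A => A vA; apply: eq_exist => /=.
by apply: gauge_fix => [i|i|i]; rewrite ?at_top1 ?unitmx1 ?mulmx1 ?mul1mx.
Qed.

Lemma kactM k l A : kact k (kact l A) = kact (k * l)%g A.
Proof.
apply: eq_exist => /=; rewrite gauge_gauge; try exact: at_top_unit.
by apply: eq_gauge => i _; rewrite at_topM.
Qed.

Lemma qact1 (chi : qmult C n) : qact 1%g chi = chi.
Proof.
apply/val_inj/funext => f /=; congr (val chi _); apply/val_inj/funext => A /=.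
by rewrite kact1.
Qed.

Lemma qactM k l (chi : qmult C n) : qact k (qact l chi) = qact (k * l)%g chi.
Proof.
apply/val_inj/funext => f /=; congr (val chi _); apply/val_inj/funext => A /=.
by rewrite kactM.
Qed.

Lemma qact_stab_subgroup (chi : qmult C n) :
  is_subgroup [set k | qact k chi = chi].
Proof.
split=> [|x y hx hy|x hx] /=; first exact: qact1.
  by rewrite -qactM hy hx.
by rewrite -{1}hx qactM mulVg qact1.
Qed.

Lemma qclass_hact h A : qclass (hact h A) = qclass A.
Proof.
apply/val_inj/funext => f /=.
by have /invariantP[_ ->] := valP f.
Qed.

Lemma qclassP A B : qclass A = qclass B <->
  forall f, f \in @Defs.invariant C n -> f A = f B.
Proof.
split=> [e f fi|e].
  pose g : inv_ring C n := exist (fun f => is_true (f \in @Defs.invariant C n)) f fi.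
  exact: (congr1 (fun chi : qmult C n => val chi g) e).
by apply/val_inj/funext => f /=; apply: e; exact: (valP f).
Qed.

End Action.

Section Stabilizer.
Variables (C : numClosedFieldType) (T : eqType) (N : nat) (t : nat -> T).
Local Notation n := N.+1.
Local Notation tI := (fun i : 'I_n => t i).

Definition complete_below (m : nat) (z : T) : bool :=
  [forall i : 'I_n, (t i == z) ==> (i < m)%N].

(** The action on C^m of the blocks of k that fit in the first m coordinates;
    incomplete blocks are replaced by the identity, which makes the map
    multiplicative on block-diagonal matrices. *)
Definition corner (m : nat) (k : 'M[C]_n) : 'M[C]_m :=
  \matrix_(a < m, b < m)
    if complete_below m (t a) then k (inord a) (inord b) else (a == b)%:R.

Lemma corner0 m k (a b : 'I_m) : (m <= n)%N -> block_diag tI k ->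
  t a != t b -> corner m k a b = 0.
Proof.
move=> mn kt ab; rewrite mxE; case: ifP => _.
  by apply: kt; rewrite !inordK ?(leq_trans (ltn_ord _) mn).
by have [e|] := eqVneq a b => //; rewrite e eqxx in ab.
Qed.

Lemma corner1 m : (m <= n)%N -> corner m 1%:M = 1%:M.
Proof.
move=> mn; apply/matrixP => a b; rewrite !mxE; case: ifP => // _.
by rewrite -!(inj_eq val_inj) /= !inordK ?(leq_trans (ltn_ord _) mn).
Qed.

Lemma corner_full k : corner n k = k.
Proof.
apply/matrixP => a b; rewrite !mxE !inord_val ifT //.
by apply/forallP => i; rewrite ltn_ord implybT.
Qed.

(** On a complete block no index of the sum is lost by truncation to C^m. *)
Lemma cornerM m k l : (m <= n)%N -> block_diag tI k ->
  corner m (k *m l) = corner m k *m corner m l.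
Proof.
move=> mn kt; apply/matrixP => a b; rewrite [RHS]mxE.
have [fa|fa] := boolP (complete_below m (t a)); last first.
  rewrite (bigD1 a) //= !mxE (negbTE fa) eqxx mul1r big1 ?addr0 // => c ca.
  by rewrite !mxE (negbTE fa) eq_sym (negbTE ca) mul0r.
have an : (a < n)%N := leq_trans (ltn_ord a) mn.
rewrite !mxE fa (bigID (fun c : 'I_n => (c < m)%N)) /= addrC big1 ?add0r.
  rewrite (big_ord_narrow mn) /=.
  apply: eq_big => // c _; rewrite !mxE fa.
  have cE : inord c = widen_ord mn c.
    by apply/val_inj; rewrite /= inordK // (leq_trans (ltn_ord c) mn).
  rewrite cE; have [ac|ac] := eqVneq (t a) (t c); last first.
    by rewrite kt ?mul0r // inordK.
  by rewrite -ac fa.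
move=> c cm; rewrite kt ?mul0r // inordK //.
by apply: contra cm => /eqP ac; move/forallP/(_ c): fa; rewrite ac eqxx.
Qed.

Lemma corner_unit m (k : SU C n) : (m <= n)%N -> block_diag tI (val k) ->
  corner m (val k) \in unitmx.
Proof.
move=> mn kt; have := cornerM (invmx (val k)) mn kt.
rewrite mulmxV ?su_unit // corner1 // => /esym.
by move/mulmx1_unit => [].
Qed.

(** The factors need not have corners of determinant 1: it is as a commutator
    that the corner has determinant 1. *)
Lemma det_corner_commg m (k l : SU C n) : (m <= n)%N ->
  block_diag tI (val k) -> block_diag tI (val l) ->
  \det (corner m (val (commg k l))) = 1.
Proof.
move=> mn kt lt; have dU (x : SU C n) (xt : block_diag tI (val x)) :
    \det (corner m (val x)) != 0.
  by rewrite -unitfE -unitmxE corner_unit.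
apply: (mulfI (mulf_neq0 (dU _ lt) (dU _ kt))); rewrite mulr1.
have [_ KM _] := block_centralizer_subgroup C tI.
have dM (x y : SU C n) (xt : block_diag tI (val x)) :
    \det (corner m (val (x * y)%g)) =
    \det (corner m (val x)) * \det (corner m (val y)).
  by rewrite val_suM cornerM // det_mulmx.
rewrite -dM // -dM; last exact: KM.
by rewrite -commgC !dM // mulrC.
Qed.

(** The corners i and i+1 agree outside the color of the index i, and c
    annihilates that color. *)
Lemma corner_comm_up (i : 'I_n) (x : 'M[C]_(i.+1, i)) (c : T -> C) k :
  block_diag tI k -> c (t i) = 0 ->
  x = \matrix_(a, b) (if a == b :> nat then c (t b) else 0) ->
  corner i.+1 k *m x = x *m corner i k.
Proof.
move=> kt ci ->; apply/matrixP => a b.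
have bi := ltn_ord b; have iN := ltn_ord i.
rewrite mxE (bigD1 (widen_ord (leqnSn i) b)) //= big1 ?addr0; last first.
  move=> d db; rewrite [X in _ * X]mxE (_ : (d == b :> nat) = false) ?mulr0 //.
  exact: negbTE db.
rewrite [X in _ * X]mxE eqxx.
have cornerS d : t d != t i -> complete_below i.+1 (t d) = complete_below i (t d).
  move=> di; apply: eq_forallb => j; rewrite ltnS leq_eqVlt.
  have [e|_] := eqVneq (j : nat) i; last by [].
  by rewrite e eq_sym (negbTE di).
have [ai|] := ltnP a i.
  rewrite [RHS]mxE (bigD1 (Ordinal ai)) //= big1 ?addr0; last first.
    move=> d da; rewrite [X in X * _]mxE (_ : (a == d :> nat) = false) ?mul0r //.
    by apply: negbTE; rewrite eq_sym; exact: da.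
  rewrite [X in _ = X * _]mxE eqxx.
  have [ab|ab] := eqVneq (t a) (t b); last first.
    by rewrite !corner0 ?mul0r ?mulr0 // ltnW.
  rewrite -ab mulrC; have [ati|ati] := eqVneq (t a) (t i).
    by rewrite ati ci !mul0r.
  by congr (_ * _); rewrite !mxE /= cornerS.
move=> ia; have {ia}ai : a = i :> nat.
  by apply/eqP; rewrite eqn_leq ia -ltnS ltn_ord.
rewrite [RHS]mxE big1 => [|d _]; last first.
  by rewrite [X in X * _]mxE ai gtn_eqF ?mul0r // ltn_ord.
have [bti|bti] := eqVneq (t i) (t b); first by rewrite -bti ci mulr0.
by rewrite corner0 ?mul0r // ai.
Qed.

Lemma tr_block_diag (k : 'M[C]_n) : block_diag tI k -> block_diag tI k^T.
Proof. by move=> kt a b ab; rewrite mxE kt // eq_sym. Qed.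

Lemma tr_corner m k : (m <= n)%N -> block_diag tI k ->
  (corner m k)^T = corner m k^T.
Proof.
move=> mn kt; apply/matrixP => a b; rewrite mxE.
have [ab|ab] := eqVneq (t a) (t b).
  by rewrite !mxE ab; case: ifP => // _; rewrite eq_sym.
by rewrite !corner0 // ?[t b == _]eq_sym //; exact: tr_block_diag.
Qed.

Lemma corner_comm_down (i : 'I_n) (y : 'M[C]_(i, i.+1)) (c : T -> C) k :
  block_diag tI k -> c (t i) = 0 ->
  y = \matrix_(a, b) (if a == b :> nat then c (t a) else 0) ->
  corner i k *m y = y *m corner i.+1 k.
Proof.
move=> kt ci yE; apply: trmx_inj; rewrite !trmx_mul.
rewrite !tr_corner // ?(ltnW (ltn_ord i)) //; apply/esym.
apply: corner_comm_up (tr_block_diag kt) ci _.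
by apply/matrixP => a b; rewrite yE !mxE eq_sym.
Qed.

(** Composing k with the corners of k below the top vertex gives a change of
    basis which fixes the diagonal tuple A, and the corners belong to H_C. *)
Lemma diag_quiver_stab (A : mult_var C n) (c : 'I_n -> T -> C) (k : SU C n) :
  (forall i : 'I_n, c i (t i) = 0) ->
  (forall i : 'I_n, qalpha (sval A) i =
     \matrix_(a, b) if a == b :> nat then c i (t b) else 0) ->
  (forall i : 'I_n, qbeta (sval A) i =
     \matrix_(a, b) if a == b :> nat then c i (t a) else 0) ->
  block_centralizer tI k ->
  (forall m, (m <= n)%N -> \det (corner m (val k)) = 1) ->
  qact k (qclass A) = qclass A.
Proof.
move=> c0 aE bE kt dk.
pose h i := if (i < n)%N then corner i (val k) else 1%:M.
have hP i : \det (h i) = 1 /\ ((n <= i)%N -> h i = 1%:M).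
  rewrite /h; have [iN|iN] := ltnP i n; last by rewrite det1.
  by rewrite dk // ltnW.
pose H : Hgroup C n := exist _ h hP.
rewrite qclass_kact -(qclass_hact H); congr qclass.
case: A aE bE => A vA /= aE bE; apply: eq_exist => /=.
have uc m : (m <= n)%N -> corner m (val k) \in unitmx.
  by move=> mn; rewrite unitmxE dk ?unitr1.
rewrite gauge_gauge; [|exact: (Hgroup_unit H)|exact: at_top_unit].
pose g i := if (i <= n)%N then corner i (val k) else 1%:M.
have gE i : (i <= n)%N -> g i = corner i (val k) by rewrite /g => ->.
(* Below the top vertex the component is the corner of k; at the top vertex it
   is k itself, which is its n-th corner. *)
rewrite (@eq_gauge _ _ _ g) => [|i iN]; last first.
  rewrite gE // /h; have [->|ni] := eqVneq i n.
    by rewrite ltnn mul1mx /at_top conform_mx_id corner_full.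
  by rewrite at_top_neq // mulmx1 ltn_neqAle ni iN.
apply: gauge_fix => [i|i|i].
- by rewrite /g; case: ifP => [/uc//|_]; exact: unitmx1.
- rewrite !gE //; last exact/ltnW/ltn_ord.
  by apply: corner_comm_up kt (c0 i) (aE i).
- rewrite !gE //; last exact/ltnW/ltn_ord.
  by apply: corner_comm_down kt (c0 i) (bE i).
Qed.

End Stabilizer.

(** * Regular functions built from composites of quiver maps *)

Section RegularMatrices.
Variables (C : numClosedFieldType) (n : nat).
Local Notation V := (mult_var C n).

Definition regular_mx p q (F : V -> 'M[C]_(p, q)) : Prop :=
  forall a b, regular (fun A => F A a b).

Lemma regular_mx_cst p q (x : 'M[C]_(p, q)) : regular_mx (fun _ : V => x).
Proof. by move=> a b; exact: RegConst. Qed.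

Lemma regular_mxD p q (F G : V -> 'M[C]_(p, q)) :
  regular_mx F -> regular_mx G -> regular_mx (fun A => F A + G A).
Proof.
move=> rF rG a b; have := RegAdd (rF a b) (rG a b).
by congr regular; apply/funext => A; rewrite mxE.
Qed.

Lemma regular_mxM p q r (F : V -> 'M[C]_(p, q)) (G : V -> 'M[C]_(q, r)) :
  regular_mx F -> regular_mx G -> regular_mx (fun A => F A *m G A).
Proof.
move=> rF rG a b.
have := regular_sum (fun j => RegMul (rF a j) (rG j b)).
by congr regular; apply/funext => A; rewrite mxE.
Qed.

Lemma regular_prod (I : Type) (r : seq I) (F : I -> V -> C) :
  (forall i, regular (F i)) -> regular (fun A => \prod_(i <- r) F i A).
Proof.
move=> rF; elim: r => [|i r IH].
  have := RegConst n (1 : C); congr regular; apply/funext => A.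
  by rewrite big_nil.
have := RegMul (rF i) IH; congr regular; apply/funext => A.
by rewrite big_cons.
Qed.

Lemma regular_det p (F : V -> 'M[C]_p) :
  regular_mx F -> regular (fun A => \det (F A)).
Proof.
move=> rF; apply: (@regular_sum C n _ (fun (s : 'S_p) A =>
  (-1) ^+ s * \prod_i F A i (s i))) => s.
apply: (@RegMul C n (fun=> (-1) ^+ s)); first exact: RegConst.
by apply: (@regular_prod _ _ (fun i A => F A i (s i))) => i; exact: rF.
Qed.

End RegularMatrices.

Section Composites.
Variables (C : numClosedFieldType) (n : nat).
Implicit Types (A : quiver C n) (g : forall i : nat, 'M[C]_i).

(** Indexing by all natural numbers, with value 0 out of range, keeps the sizes
    of composites computable. *)
Definition alpha_at A i : 'M[C]_(i.+1, i) :=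
  match (i < n)%N =P true with
  | ReflectT h => qalpha A (Ordinal h)
  | ReflectF _ => 0
  end.

Definition beta_at A i : 'M[C]_(i, i.+1) :=
  match (i < n)%N =P true with
  | ReflectT h => qbeta A (Ordinal h)
  | ReflectF _ => 0
  end.

Lemma alpha_atE A (i : 'I_n) : alpha_at A i = qalpha A i.
Proof.
rewrite /alpha_at; case: i => i iN /=; case: eqP => [h|/(_ iN)[]].
by rewrite (bool_irrelevance h iN).
Qed.

Lemma beta_atE A (i : 'I_n) : beta_at A i = qbeta A i.
Proof.
rewrite /beta_at; case: i => i iN /=; case: eqP => [h|/(_ iN)[]].
by rewrite (bool_irrelevance h iN).
Qed.

Lemma alpha_at_gauge g A i : (i < n)%N ->
  alpha_at (gauge g A) i = g i.+1 *m alpha_at A i *m invmx (g i).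
Proof. by move=> iN; rewrite !(alpha_atE _ (Ordinal iN)). Qed.

Lemma beta_at_gauge g A i : (i < n)%N ->
  beta_at (gauge g A) i = g i *m beta_at A i *m invmx (g i.+1).
Proof. by move=> iN; rewrite !(beta_atE _ (Ordinal iN)). Qed.

Lemma regular_alpha_at i : regular_mx (fun A : mult_var C n => alpha_at (sval A) i).
Proof.
move=> a b; rewrite /alpha_at; case: eqP => [h|_].
  exact: RegAlpha.
exact: (@regular_mx_cst C n _ _ 0).
Qed.

Lemma regular_beta_at i : regular_mx (fun A : mult_var C n => beta_at (sval A) i).
Proof.
move=> a b; rewrite /beta_at; case: eqP => [h|_].
  exact: RegBeta.
exact: (@regular_mx_cst C n _ _ 0).
Qed.

(** The composite of the maps alpha from C^m to C^(k+m). *)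
Fixpoint up A k m : 'M[C]_(k + m, m) :=
  if k is k'.+1 then alpha_at A (k' + m) *m up A k' m else 1%:M.

(** The composite of the maps beta from C^(k+m) to C^m. *)
Fixpoint down A k m : 'M[C]_(m, k + m) :=
  if k is k'.+1 then down A k' m *m beta_at A (k' + m) else 1%:M.

Lemma up_gauge g A k m : (forall i, g i \in unitmx) -> (k + m <= n)%N ->
  up (gauge g A) k m = g (k + m) *m up A k m *m invmx (g m).
Proof.
move=> ug; elim: k => [|k IH] kn; first by rewrite /= mulmx1 mulmxV.
have kn' : (k + m < n)%N := kn.
rewrite /= alpha_at_gauge // IH 1?ltnW //.
by rewrite -!mulmxA (mulmxA (invmx (g (k + m)))) mulVmx // mul1mx.
Qed.

Lemma down_gauge g A k m : (forall i, g i \in unitmx) -> (k + m <= n)%N ->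
  down (gauge g A) k m = g m *m down A k m *m invmx (g (k + m)).
Proof.
move=> ug; elim: k => [|k IH] kn; first by rewrite /= mulmx1 mulmxV.
have kn' : (k + m < n)%N := kn.
rewrite /= beta_at_gauge // IH 1?ltnW //.
by rewrite -!mulmxA (mulmxA (invmx (g (k + m)))) mulVmx // mul1mx.
Qed.

Lemma regular_up k m : regular_mx (fun A : mult_var C n => up (sval A) k m).
Proof.
elim: k => [|k IH]; first exact: regular_mx_cst.
exact: (regular_mxM (@regular_alpha_at (k + m)) IH).
Qed.

Lemma regular_down k m : regular_mx (fun A : mult_var C n => down (sval A) k m).
Proof.
elim: k => [|k IH]; first exact: regular_mx_cst.
exact: (regular_mxM IH (@regular_beta_at (k + m))).
Qed.

Lemma up_diag A k m (x : nat -> nat -> C) :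
  (forall i : 'I_n, qalpha A i =
     \matrix_(a, b) if a == b :> nat then x i b else 0) ->
  (k + m <= n)%N ->
  up A k m =
  \matrix_(a, b) if a == b :> nat then \prod_(m <= i < k + m) x i a else 0.
Proof.
move=> aE; elim: k => [|k IH] kn.
  by apply/matrixP => a b; rewrite !mxE big_geq // -(inj_eq val_inj); case: ifP.
have kn' : (k + m < n)%N := kn.
rewrite /= IH 1?ltnW // (alpha_atE _ (Ordinal kn')) aE.
apply/matrixP => a b; rewrite !mxE.
have bk : (b < k + m)%N by rewrite (leq_trans (ltn_ord b)) ?leq_addl.
rewrite (bigD1 (Ordinal bk)) //= big1 ?addr0 => [|d db]; last first.
  rewrite !mxE (_ : (d == b :> nat) = false) ?mulr0 //; exact: negbTE db.
rewrite !mxE eqxx /=; case: eqVneq => [->|_]; last by rewrite mul0r.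
by rewrite big_nat_recr ?leq_addl //= mulrC.
Qed.

Lemma down_diag A k m (x : nat -> nat -> C) :
  (forall i : 'I_n, qbeta A i =
     \matrix_(a, b) if a == b :> nat then x i a else 0) ->
  (k + m <= n)%N ->
  down A k m =
  \matrix_(a, b) if a == b :> nat then \prod_(m <= i < k + m) x i a else 0.
Proof.
move=> aE; elim: k => [|k IH] kn.
  by apply/matrixP => a b; rewrite !mxE big_geq // -(inj_eq val_inj); case: ifP.
have kn' : (k + m < n)%N := kn.
rewrite /= IH 1?ltnW // (beta_atE _ (Ordinal kn')) aE.
apply/matrixP => a b; rewrite !mxE.
have ak : (a < k + m)%N by rewrite (leq_trans (ltn_ord a)) ?leq_addl.
rewrite (bigD1 (Ordinal ak)) //= big1 ?addr0 => [|d da]; last first.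
  rewrite !mxE (_ : (a == d :> nat) = false) ?mul0r //.
  by apply: negbTE; rewrite eq_sym; exact: da.
rewrite !mxE eqxx /=; case: ifP => _; last by rewrite mulr0.
by rewrite big_nat_recr ?leq_addl //= mulrC.
Qed.

End Composites.

Section PartialIdentity.
Variable C : comNzRingType.

(** All the selection and inclusion matrices used below have this form, so that
    part_idM and eq_part_id compute every product of them. *)
Definition part_id (f : pred nat) p q : 'M[C]_(p, q) :=
  \matrix_(a, b) ((a == b :> nat) && f a)%:R.

Lemma part_idM f g p q r :
  part_id f p q *m part_id g q r =
  part_id (fun a => [&& f a, g a & (a < q)%N]) p r.
Proof.
apply/matrixP => a b; rewrite !mxE; have [aq|aq] := ltnP a q; last first.
  rewrite !andbF big1 // => c _; rewrite !mxE.
  by rewrite gtn_eqF ?mul0r // (leq_trans (ltn_ord c)).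
rewrite (bigD1 (Ordinal aq)) //= !mxE eqxx big1 ?addr0 => [|c ca].
  by rewrite andbT -natrM mulnb andbCA.
rewrite !mxE (_ : (a == c :> nat) = false) ?mul0r //.
by apply: negbTE; rewrite eq_sym; exact: ca.
Qed.

Lemma eq_part_id f g p q : (forall a, (a < p)%N -> (a < q)%N -> f a = g a) ->
  part_id f p q = part_id g p q.
Proof.
move=> fg; apply/matrixP => a b; rewrite !mxE.
by have [e|//] := eqVneq (a : nat) b; rewrite fg // e.
Qed.

Lemma tr_part_id f p q : (part_id f p q)^T = part_id f q p.
Proof.
by apply/matrixP => a b; rewrite !mxE eq_sym; case: eqVneq => // ->.
Qed.

Lemma part_id1 p : part_id xpredT p p = 1%:M.
Proof. by apply/matrixP => a b; rewrite !mxE andbT. Qed.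

Lemma part_id0 p q : part_id xpred0 p q = 0.
Proof. by apply/matrixP => a b; rewrite !mxE andbF. Qed.

Lemma part_id_proj f p : part_id f p p = coord_proj C [set a : 'I_p | f a].
Proof.
apply/matrixP => a b; rewrite !mxE inE.
by rewrite -(inj_eq val_inj) /=; case: eqVneq => //; rewrite mulr0n.
Qed.

Lemma part_id_diag f p q r (d : nat -> C) :
  part_id f p q *m
    (\matrix_(a < q, b < r) if a == b :> nat then d a else 0) =
  \matrix_(a < p, b < r) if [&& a == b :> nat, f a & (a < q)%N] then d a else 0.
Proof.
apply/matrixP => a b; rewrite !mxE; have [aq|aq] := ltnP a q; last first.
  rewrite !andbF big1 // => c _; rewrite !mxE.
  by rewrite gtn_eqF ?mul0r // (leq_trans (ltn_ord c)).
rewrite (bigD1 (Ordinal aq)) //= !mxE eqxx big1 ?addr0 => [|c ca].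
  by rewrite andbT /=; case: (f a); case: eqP => //=;
    rewrite ?mulr0n ?mul0r ?mul1r ?mulr0.
rewrite !mxE (_ : (a == c :> nat) = false) ?mul0r //.
by apply: negbTE; rewrite eq_sym; exact: ca.
Qed.

End PartialIdentity.

(** * Invariants of the quiver variety *)

Lemma det_at_top (C : numClosedFieldType) n (k : SU C n) i :
  \det (at_top (val k) i) = 1.
Proof.
have [->|ni] := eqVneq i n; last by rewrite at_top_neq // det1.
by rewrite /at_top conform_mx_id; have /andP[_ /eqP] := valP k.
Qed.

Section IntervalInvariant.
Variables (C : numClosedFieldType) (r q p : nat).
Local Notation m := (q + p)%N.
Local Notation n := (r + m)%N.
Implicit Types (A : mult_var C n).

Local Notation X := (part_id C xpredT m p).
Local Notation Y := (part_id C (leq p) m n).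

(** The rows a < p come from the descent to C^p and the rows p <= a from the
    ascent to C^n. *)
Definition interval_mx (A : quiver C n) : 'M[C]_m :=
  X *m down A q p + Y *m up A r m.

Definition interval_inv A : C := \det (interval_mx (sval A)).

Lemma regular_interval_inv : regular interval_inv.
Proof.
apply: regular_det; apply: regular_mxD; apply: regular_mxM.
- exact: regular_mx_cst.
- exact: regular_down.
- exact: regular_mx_cst.
- exact: regular_up.
Qed.

Let pm : (p <= m)%N. Proof. exact: leq_addl. Qed.
Let mn : (m <= n)%N. Proof. exact: leq_addl. Qed.

Let XX : X^T *m X = 1%:M.
Proof.
rewrite tr_part_id part_idM -part_id1; apply: eq_part_id => a ap _ /=.
exact: leq_trans ap pm.
Qed.

Let XY : X^T *m Y = 0.
Proof.
rewrite tr_part_id part_idM -part_id0; apply: eq_part_id => a ap _ /=.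
by rewrite leqNgt ap.
Qed.

Let YX : Y^T *m X = 0.
Proof. by apply: trmx_inj; rewrite trmx_mul trmxK XY trmx0. Qed.

Let YYY : Y *m (Y^T *m Y) = Y.
Proof.
rewrite tr_part_id !part_idM; apply: eq_part_id => a am an /=.
by rewrite am an !andbT !andbb.
Qed.

Let YY : Y^T *m Y = coord_proj C (ord_interval n p m).
Proof.
rewrite tr_part_id part_idM part_id_proj; congr coord_proj.
by apply/setP => a; rewrite !inE andbA andbb.
Qed.

(** At the top vertex h is 1, while its component at C^p acts on the rows a < p;
    so the matrix is multiplied on both sides by matrices of determinant 1. *)
Lemma interval_inv_hact h A : interval_inv (hact h A) = interval_inv A.
Proof.
rewrite /interval_inv /interval_mx /=.
have uh := Hgroup_unit h; have hP i := (projT2 h i).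
rewrite up_gauge // down_gauge //; case: h uh hP => h hdet /= uh hP.
have [_ ->] := hP n; rewrite // mul1mx.
(* L acts as h p on the rows a < p and as 1 on the others. *)
pose L := 1%:M + X *m ((h p - 1%:M) *m X^T).
have LX : L *m X = X *m h p.
  rewrite mulmxDl mul1mx -!mulmxA XX mulmx1 mulmxBr mulmx1.
  by rewrite addrC subrK.
have LY : L *m Y = Y by rewrite mulmxDl mul1mx -!mulmxA XY !mulmx0 addr0.
rewrite !mulmxA -mulmxDl.
rewrite (_ : _ + _ = L *m interval_mx (sval A)); last first.
  by rewrite mulmxDr !mulmxA LX LY.
rewrite !det_mulmx det_1D_mulC -mulmxA XX mulmx1 addrC subrK (hP p).1 mul1r.
by rewrite det_inv (hP _).1 invr1 mulr1.
Qed.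

(** k acts on the rows p <= a only, through its block on the interval.  The
    case p = n, in which k would also act at C^p, is excluded by 0 < q. *)
Lemma interval_inv_kact (k : SU C n) A : (0 < q)%N ->
  val k *m coord_proj C (ord_interval n p m) =
  coord_proj C (ord_interval n p m) *m val k ->
  interval_inv (kact k A) =
  block_det (ord_interval n p m) (val k) * interval_inv A.
Proof.
move=> q0; rewrite -YY => kY; rewrite /interval_inv /interval_mx /=.
have uk := at_top_unit k; rewrite up_gauge // down_gauge //.
have pn : p != n by rewrite neq_ltn (leq_trans _ mn) // -[p]add0n ltn_add2r.
rewrite (at_top_neq _ pn) mul1mx [at_top (val k) n]conform_mx_id.
(* L acts as the block of k on the rows p <= a and as 1 on the others. *)
pose L := 1%:M + Y *m ((val k - 1%:M) *m Y^T).
have LX : L *m X = X by rewrite mulmxDl mul1mx -!mulmxA YX !mulmx0 addr0.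
have LY : L *m Y = Y *m val k.
  rewrite mulmxDl mul1mx -!mulmxA [(_ - _) *m _]mulmxBl mul1mx kY.
  by rewrite mulmxBr mulmxA YYY addrC subrK.
rewrite !mulmxA -mulmxDl.
rewrite (_ : _ + _ = L *m interval_mx (sval A)); last first.
  by rewrite mulmxDr !mulmxA LX LY.
rewrite !det_mulmx.
have -> : \det L = block_det (ord_interval n p m) (val k).
  by rewrite /L det_1D_mulC -mulmxA YY block_detE.
(* At C^m the group element is 1, or k when m = n: its determinant is 1. *)
rewrite -[RHS]mulr1; congr (_ * _); rewrite det_inv; apply: (canLR (@invrK _)).
by rewrite invr1 det_at_top.
Qed.

(** The invariant interval_inv takes the same value at k . A and A, and also
    gets multiplied by the block determinant. *)
Lemma block_det_stab (k : SU C n) A (T : {set 'I_n}) :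
  T = ord_interval n p m ->
  val k *m coord_proj C T = coord_proj C T *m val k ->
  interval_inv A != 0 ->
  qact k (qclass A) = qclass A -> block_det T (val k) = 1.
Proof.
move=> ->; have [q0|q0] := posnP q.
  move=> _ _ _; rewrite (_ : ord_interval n p m = finset.set0) ?block_det0 //.
  apply/setP => a; rewrite !inE; apply/negP => /andP[pa am].
  by have := leq_trans am (leq_add (eq_leq q0) pa); rewrite ltnn.
move=> kT A0; rewrite qclass_kact => /qclassP e; apply: (mulIf A0).
rewrite mul1r -interval_inv_kact //; apply: e; apply/invariantP.
by split; [exact: regular_interval_inv|exact: interval_inv_hact].
Qed.

End IntervalInvariant.

Section MomentMap.
Variables (C : numClosedFieldType) (N : nat).
Local Notation n := N.+1.
Implicit Types (A : mult_var C n).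

Lemma qscal_qact k k' A A' : qact k (qclass A) = qact k' (qclass A') ->
  forall i, qscal (sval A) i = qscal (sval A') i.
Proof.
rewrite !qclass_kact => /qclassP e i.
apply: (e (fun A => qscal (sval A) i)); apply/invariantP.
by split; [exact: RegScal|].
Qed.

Definition top_mx A : 'M[C]_n := alpha_at (sval A) N *m beta_at (sval A) N.

Lemma top_mx_gauge g A (gA : mult_var C n) : (forall i, g i \in unitmx) ->
  sval gA = gauge g (sval A) ->
  top_mx gA = g n *m top_mx A *m invmx (g n).
Proof.
move=> ug e; rewrite /top_mx e alpha_at_gauge // beta_at_gauge //.
by rewrite !mulmxA mulmxKV.
Qed.

Lemma top_mx_kact (k : SU C n) A :
  top_mx (kact k A) = val k *m top_mx A *m invmx (val k).
Proof.
rewrite (@top_mx_gauge (at_top (val k)) A (kact k A) (at_top_unit k)) //.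
by rewrite [at_top (val k) n]conform_mx_id.
Qed.

Lemma top_mx_qact (k : SU C n) A A' :
  qact k (qclass A) = qclass A' ->
  val k *m top_mx A *m invmx (val k) = top_mx A'.
Proof.
rewrite qclass_kact -top_mx_kact => /qclassP e; apply/matrixP => a b.
apply: (e (fun A => top_mx A a b)); apply/invariantP; split=> [|h B].
  exact: (regular_mxM (@regular_alpha_at C n N) (@regular_beta_at C n N)).
rewrite (@top_mx_gauge (projT1 h) B (hact h B) (Hgroup_unit h)) //.
by have [_ ->] := projT2 h n; rewrite // mul1mx invmx1 mulmx1.
Qed.

End MomentMap.

(** * Geometry of the alcove *)

Lemma expiN (R : realType) (x : R) : expi (- x) = (expi x)^-1.
Proof.
apply: (mulfI (expi_neq0 x)); rewrite -expiD subrr expi0 divff //.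
exact: expi_neq0.
Qed.

(** With y = x / 2, cos x = 1 gives sin y = 0, and sin is positive inside
    [0, pi]. *)
Lemma expi_eq1 (R : realType) (x : R) : 0 <= x <= 2 * pi ->
  (expi x == 1) = (x == 0) || (x == 2 * pi).
Proof.
move=> /andP[x0 x2]; apply/eqP/orP => [[cx _]|[]/eqP ->]; last 2 first.
- exact: expi0.
- by rewrite /expi mulr_natl cos2pi sin2pi.
pose y := x / 2; have xE : x = y *+ 2 by rewrite -mulr_natr divfK ?pnatr_eq0.
have sy : sin y = 0.
  apply/eqP; rewrite -sqrf_eq0 sin2cos2; move: cx; rewrite xE cos_mulr2n => cy.
  by apply/eqP; lra.
have [->|y0] := eqVneq x 0; [by left|right].
rewrite eq_le x2 leNgt; apply/negP => xlt.
have : 0 < sin y.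
  apply: sin_gt0_pi; have : 0 < x by rewrite lt_neqAle eq_sym y0.
  by move: xlt; rewrite /y => ? ?; apply/andP; split; lra.
by rewrite sy ltxx.
Qed.

Lemma expi_eq (R : realType) (x y : R) : (expi x == expi y) = (expi (x - y) == 1).
Proof.
have -> : expi x = expi (x - y) * expi y by rewrite -expiD subrK.
by rewrite -{2}[expi y]mul1r (inj_eq (mulIf (expi_neq0 _))).
Qed.

Lemma convex_ord_interval n (T : {set 'I_n}) :
  (forall a b c : 'I_n, (a <= b <= c)%N -> a \in T -> c \in T -> b \in T) ->
  exists r q p, n = (r + (q + p))%N /\ T = ord_interval n p (q + p).
Proof.
move=> Tc; have [->|[a0 a0T]] := set_0Vmem T.
  exists n, 0%N, 0%N; split; first by rewrite !addn0.
  by apply/setP => a; rewrite !inE.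
have [p pT pmin] := arg_minnP (fun a : 'I_n => a : nat) a0T.
have [m mT mmax] := arg_maxnP (fun a : 'I_n => a : nat) a0T.
have pm : (p <= m)%N := pmin m mT; have mn := ltn_ord m.
exists (n - m.+1)%N, (m.+1 - p)%N, (p : nat).
have e : (m.+1 - p + p)%N = m.+1 by rewrite subnK // ltnW.
split; first by rewrite e subnK.
apply/setP => a; rewrite inE e ltnS; apply/idP/idP => [aT|pam].
  by apply/andP; split; [exact: pmin|exact: mmax].
exact: Tc pam pT mT.
Qed.

(** Two indices of S have values of y that are equal or 2 pi apart.  If S misses
    an index between two of its elements, the second case occurs, and y takes
    its minimum and its maximum on S; the complement of S is then the set of
    indices with intermediate values, which is convex. *)
Lemma expi_level_interval (R : realType) n (y : 'I_n -> R) z :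
  {homo y : a b / (a <= b)%N >-> a <= b} ->
  (forall a b, y b - y a <= 2 * pi) ->
  let S := color_class (fun a => expi (y a)) z in
  exists2 T : {set 'I_n}, T = S \/ T = ~: S &
  exists r q p, n = (r + (q + p))%N /\ T = ord_interval n p (q + p).
Proof.
move=> ym y2 S.
have SE (a b : 'I_n) : (a <= b)%N -> a \in S -> b \in S ->
    y b = y a \/ y b - y a = 2 * pi.
  rewrite !inE => ab /eqP az /eqP bz.
  have : expi (y b) == expi (y a) by rewrite /= in az bz; rewrite az bz.
  rewrite expi_eq expi_eq1 ?subr_ge0 ?ym ?y2 //.
  by rewrite subr_eq0 => /orP[]/eqP; [left|right].
have SI (a b : 'I_n) : y a = y b -> a \in S -> b \in S.
  by rewrite !inE /= => ->.
have [/forallP cS|/forallPn[a /forallPn[b /forallPn[c]]]] := boolP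
    [forall a : 'I_n, forall b : 'I_n, forall c : 'I_n,
      [&& (a <= b <= c)%N, a \in S & c \in S] ==> (b \in S)].
  exists S; [by left|apply: convex_ord_interval => a b c abc aS mS].
  by have /forallP/(_ b)/forallP/(_ c) := cS a; rewrite abc aS mS.
rewrite negb_imply => /andP[/and3P[/andP[ab bc] aS cS] bS].
have [yac|yac] := SE a c (leq_trans ab bc) aS cS.
  case/negP: bS; apply: (SI a) => //; apply/eqP.
  by rewrite eq_le ym //= -yac ym.
exists (~: S); [by right|apply: convex_ord_interval => u v w /andP[uv vw]].
rewrite !finset.in_setC => uS wS; apply/negP => vS.
have hi d : y d <= y c by have := y2 a d; rewrite -yac lerD2r.
have lo d : y a <= y d by have := y2 d c; rewrite -yac lerD2l lerN2.
have [av|va] := leqP a v.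
  have [yv|yv] := SE a v av aS vS.
    case/negP: uS; apply: (SI a) => //; apply/eqP.
    by rewrite eq_le lo -yv ym.
  case/negP: wS; apply: (SI c) => //; apply/eqP.
  rewrite eq_le hi andbT.
  have -> : y c = y v by apply: (addIr (- y a)); rewrite yac yv.
  exact: ym.
case/negP: uS; apply: (SI a) => //; apply/eqP.
by rewrite eq_le lo (le_trans (ym _ _ uv)) // ym // ltnW.
Qed.

Section AlcoveGaps.
Variables (R : realType) (n : nat).
Implicit Types theta : alcove R n.

Lemma coordE (v : 'rV[R]_n) (i : 'I_n) : Defs.coord v i.+1 = v 0 i.
Proof. by rewrite /Defs.coord /= valK. Qed.

Lemma alcove_gap_ge0 theta (j : 'I_n) : 0 <= gap (val theta) j.+1.
Proof. by have /andP[_ /forallP] := valP theta; apply. Qed.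

(** The gaps from i to j telescope; the last gap, the only one involving 2 pi,
    does not occur as j <= n. *)
Lemma coord_diff (v : 'rV[R]_n) i j : (0 < i)%N -> (i <= j)%N -> (j <= n)%N ->
  Defs.coord v i - Defs.coord v j = \sum_(l < n | (i <= l.+1 < j)%N) gap v l.+1.
Proof.
move=> i0; elim: j => [|j IH]; first by rewrite leqn0 => /eqP i00; rewrite i00 in i0.
rewrite leq_eqVlt => /predU1P[<-|ij] jn.
  by rewrite subrr big1 // => l; rewrite ltnNge andbN.
have j0 : (0 < j)%N by exact: leq_trans i0 ij.
have jn' : (j.-1 < n)%N by rewrite prednK // ltnW.
rewrite (bigD1 (Ordinal jn')) /= ?prednK ?ltnSn ?andbT //.
rewrite [gap v j]/gap (jn : (j < n)%N).
rewrite (eq_bigl (fun l : 'I_n => (i <= l.+1 < j)%N)).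
  by rewrite -IH // 1?ltnW //; lra.
by move=> l; rewrite -(inj_eq val_inj) /=; lia.
Qed.

Lemma sum_gap (v : 'rV[R]_n) : (0 < n)%N -> \sum_(l < n) gap v l.+1 = 2 * pi.
Proof.
move=> n0; have pn : (n.-1 < n)%N by rewrite prednK.
rewrite (bigD1 (Ordinal pn)) //= prednK // /gap ltnn -/(gap v _).
rewrite (eq_bigl (fun l : 'I_n => (1 <= l.+1 < n)%N)).
  by rewrite -/(gap v) -coord_diff //; lra.
by move=> l; rewrite -(inj_eq val_inj) /=; have := ltn_ord l; lia.
Qed.

(** The gaps separating the phases of t(theta) at the positions a <= b; the
    phases increase along the diagonal, the position a holding the coordinate
    n - a. *)
Definition between (a b : 'I_n) : pred 'I_n :=
  fun j => (n - b <= j.+1 < n - a)%N.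

Lemma phase_diff theta (a b : 'I_n) : (a <= b)%N ->
  Defs.coord (val theta) (n - b) - Defs.coord (val theta) (n - a) =
  \sum_(j | between a b j) gap (val theta) j.+1.
Proof.
by move=> ab; rewrite coord_diff ?subn_gt0 ?leq_sub2l ?leq_subr.
Qed.

Lemma phase_homo theta :
  {homo (fun a : 'I_n => Defs.coord (val theta) (n - a)) :
    a b / (a <= b)%N >-> a <= b}.
Proof.
move=> a b ab; rewrite -subr_ge0 phase_diff //; apply: sumr_ge0 => j _.
exact: alcove_gap_ge0.
Qed.

Lemma phase_width theta (a b : 'I_n) :
  Defs.coord (val theta) (n - b) - Defs.coord (val theta) (n - a) <= 2 * pi.
Proof.
have n0 : (0 < n)%N := leq_ltn_trans (leq0n a) (ltn_ord a).
have [ab|/ltnW ba] := leqP a b.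
  rewrite phase_diff // -(sum_gap (val theta) n0).
  rewrite [leRHS](bigID (between a b)) /= lerDl.
  by apply: sumr_ge0 => j _; exact: alcove_gap_ge0.
by rewrite (le_trans (y := 0)) ?subr_le0 ?phase_homo // mulr_ge0 ?pi_ge0.
Qed.

Lemma torus_diagE theta a : torus_diag theta a = expi (Defs.coord (val theta) (n - a)).
Proof. by rewrite /torus_diag !mxE eqxx mulr1n. Qed.

(** The two phases differ by the sum of the gaps between them, which lies in
    [0, 2 pi] and is 0 or 2 pi exactly when the gaps between, or the remaining
    gaps, all vanish. *)
Lemma torus_diag_eq theta (S : {set 'I_n}) (a b : 'I_n) :
  open_face S theta -> (a <= b)%N ->
  (torus_diag theta a == torus_diag theta b) =
  [forall j, between a b j ==> (j \in S)] ||
  [forall j, ~~ between a b j ==> (j \in S)].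
Proof.
move=> fS ab; have n0 : (0 < n)%N := leq_ltn_trans (leq0n a) (ltn_ord a).
rewrite eq_sym !torus_diagE expi_eq expi_eq1; last first.
  by rewrite phase_width subr_ge0 phase_homo.
have sum0 (P : pred 'I_n) : (\sum_(j | P j) gap (val theta) j.+1 == 0) =
    [forall j, P j ==> (j \in S)].
  rewrite psumr_eq0 => [|j _]; last exact: alcove_gap_ge0.
  apply/allP/forallP => [h j|h j _]; first by rewrite -fS h ?mem_index_enum.
  by rewrite fS; exact: h.
rewrite phase_diff // sum0; congr (_ || _); rewrite -sum0.
by rewrite -(sum_gap (val theta) n0) [X in _ == X](bigID (between a b)) /=
  -[X in X == _]addr0 (inj_eq (addrI _)) eq_sym.
Qed.

(** The differences d of coordinates satisfy |d_i - d_j| <= 2 pi and have sum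
    0, so n |d_i| <= (n - 1) 2 pi; as expi (d_i) = 1, d_i vanishes. *)
Lemma torus_inj theta theta' : torus theta = torus theta' -> theta = theta'.
Proof.
move=> e; apply/val_inj/rowP => i.
have n0 : (0 < n)%N := leq_ltn_trans (leq0n i) (ltn_ord i).
pose d j := val theta 0 j - val theta' 0 j.
have phaseE (th : alcove R n) (j : 'I_n) :
    Defs.coord (val th) (n - rev_ord j) = val th 0 j.
  by rewrite /= subKn // coordE.
have d1 j : expi (d j) = 1.
  apply/eqP; rewrite -expi_eq -!phaseE -!torus_diagE.
  by rewrite /torus_diag e.
have dd j l : `|d j - d l| <= 2 * pi.
  wlog jl : j l / (j <= l)%N => [h|].
    have [jl|/ltnW lj] := leqP j l; first exact: h.
    by rewrite distrC h.
  have rjl : (rev_ord l <= rev_ord j)%N by rewrite /= leq_sub2l.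
  have := phase_homo theta rjl; have := phase_homo theta' rjl.
  have := phase_width theta (rev_ord l) (rev_ord j).
  have := phase_width theta' (rev_ord l) (rev_ord j).
  rewrite !phaseE /d => h1 h2 h3 h4; rewrite ler_norml; apply/andP; split; lra.
have sd : \sum_j d j = 0.
  have /andP[/eqP t0 _] := valP theta; have /andP[/eqP t0' _] := valP theta'.
  by rewrite sumrB t0 t0' subrr.
have nd : n%:R * d i = \sum_(j < n | j != i) (d i - d j).
  rewrite -[RHS]add0r -[X in X + _](subrr (d i)) -(bigD1 i (P := predT)) //.
  by rewrite sumrB sd subr0 sumr_const card_ord mulr_natl.
have small : n%:R * `|d i| <= (n.-1)%:R * (2 * pi).
  rewrite -[n%:R]normr_nat -normrM nd (le_trans (ler_norm_sum _ _ _)) //.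
  rewrite (le_trans (ler_sum _ (fun j _ => dd i j))) // sumr_const.
  by rewrite cardC1 card_ord [leRHS]mulr_natl.
have pi0 := pi_gt0 R.
have dlt : `|d i| < 2 * pi.
  rewrite -(ltr_pM2l (x := n%:R)) ?ltr0n // (le_lt_trans small) //.
  by rewrite ltr_pM2r ?mulr_gt0 // ltr_nat prednK.
suff : `|d i| == 0 by rewrite normr_eq0 subr_eq0 => /eqP.
have : (`|d i| == 0) || (`|d i| == 2 * pi).
  rewrite -expi_eq1 ?normr_ge0 ?ltW //.
  have [_|_] := ger0P (d i); first by rewrite d1.
  by rewrite -[X in expi X]add0r -expi_eq expi0 d1.
by rewrite [X in _ || X]lt_eqF ?orbF.
Qed.

Lemma open_face_zero_gaps theta :
  open_face (finset (fun j : 'I_n => gap (val theta) j.+1 == 0)) theta.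
Proof. by move=> j; rewrite inE. Qed.

Lemma open_face_inj (S S' : {set 'I_n}) theta :
  open_face S theta -> open_face S' theta -> S = S'.
Proof. by move=> fS fS'; apply/setP => j; rewrite -fS fS'. Qed.

End AlcoveGaps.

(** * Vertices of the alcove *)

Section Vertices.
Variables (R : realType) (n : nat).
Implicit Types theta : alcove R n.

(** c is the mean of ind, so the sum of the coordinates is unchanged; raising
    those with indices in ]j1, j2] moves the amount e from the gap j1 to the gap
    j2. *)
Lemma shift_gap (v : 'rV[R]_n) (e : R) (j1 j2 j : 'I_n) : (j1 < j2)%N ->
  let ind (i : nat) : R := (j1 < i <= j2)%N%:R in
  let c := n%:R^-1 * \sum_(i < n) ind i in
  gap (\row_i (v 0 i + e * (ind i - c))) j.+1 =
  gap v j.+1 + e * ((j == j2)%:R - (j == j1)%:R).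
Proof.
move=> j12 ind c; set w := \row_i _.
have wE (i : nat) : (i < n)%N ->
    Defs.coord w i.+1 = Defs.coord v i.+1 + e * (ind i - c).
  by move=> iN; rewrite !(coordE _ (Ordinal iN)) mxE.
have n0 : (0 < n)%N := leq_ltn_trans (leq0n j) (ltn_ord j).
have jn := ltn_ord j; have j2n := ltn_ord j2.
rewrite /gap; case: ifP => jS.
  rewrite !wE // /ind -!(inj_eq val_inj) /=.
  have [->|nj1] := eqVneq (j : nat) j1.
    by rewrite ltnn ltnS leqnn j12 ltn_eqF //=; ring.
  have [->|nj2] := eqVneq (j : nat) j2.
    by rewrite ltnn andbF j12 leqnn /=; ring.
  have -> : (j1 < j.+1 <= j2)%N = (j1 < j <= j2)%N by lia.
  by ring.
have jE : j.+1 = n by apply/eqP; rewrite eqn_leq jn leqNgt jS.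
rewrite -[X in Defs.coord w X]jE -[X in Defs.coord v X]jE !wE // /ind ltn0 /=.
have -> : (j == j1) = false by rewrite -(inj_eq val_inj) /=; lia.
have -> : (j == j2) = (j1 < j <= j2)%N by rewrite -(inj_eq val_inj) /=; lia.
by rewrite jE /=; ring.
Qed.

Lemma vertex_unique_gap (S : {set 'I_n}) (v : alcove R n) (j1 j2 : 'I_n) :
  open_face S = [set v] -> (j1 < j2)%N -> (j1 \in S) || (j2 \in S).
Proof.
move=> Sv j12; apply/negPn/negP; rewrite negb_or => /andP[j1S j2S].
have fv : open_face S v by rewrite Sv.
(* Moving half of the gap j1 to the gap j2 stays in the face. *)
pose e := gap (val v) j1.+1 / 2.
have gpos j : j \notin S -> 0 < gap (val v) j.+1.
  by move=> jS; rewrite lt_neqAle alcove_gap_ge0 andbT eq_sym fv.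
have e0 : 0 < e by rewrite divr_gt0 ?gpos.
pose ind (i : nat) : R := (j1 < i <= j2)%N%:R.
pose c := n%:R^-1 * \sum_(i < n) ind i.
pose w : 'rV[R]_n := \row_i (val v 0 i + e * (ind i - c)).
have wgap (j : 'I_n) :
    gap w j.+1 = gap (val v) j.+1 + e * ((j == j2)%:R - (j == j1)%:R).
  exact: shift_gap.
have ne12 : j2 != j1 by rewrite -(inj_eq val_inj) /= gtn_eqF.
have face (j : 'I_n) : (gap w j.+1 == 0) = (j \in S) /\ 0 <= gap w j.+1.
  rewrite wgap; have [->|nj1] := eqVneq j j1.
    have g1 := gpos _ j1S; rewrite [j1 == j2]eq_sym (negbTE ne12) (negbTE j1S).
    have h : 0 < gap (val v) j1.+1 + e * (0 - 1) by rewrite /e; lra.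
    by rewrite gt_eqF // ltW.
  have [->|nj2] := eqVneq j j2.
    have g2 := gpos _ j2S; rewrite (negbTE j2S).
    have h : 0 < gap (val v) j2.+1 + e * (1 - 0) by lra.
    by rewrite gt_eqF // ltW.
  by rewrite subrr mulr0 addr0 fv alcove_gap_ge0.
have wa : alcove_pred w.
  apply/andP; split; last by apply/forallP => j; case: (face j).
  have /andP[/eqP v0 _] := valP v; apply/eqP.
  under eq_bigr do rewrite mxE.
  rewrite big_split /= v0 add0r -mulr_sumr sumrB sumr_const card_ord.
  rewrite -mulr_natl mulrA mulfV ?mul1r ?subrr ?mulr0 // pnatr_eq0.
  by rewrite -lt0n (leq_ltn_trans (leq0n j1) (ltn_ord j1)).
pose w' : alcove R n := exist (fun z => is_true (alcove_pred z)) w wa.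
have : open_face S w' by move=> j; case: (face j).
rewrite Sv => /(congr1 val) /= wv; have := wgap j2.
rewrite wv eqxx (negbTE ne12) subr0 mulr1 => /eqP.
by rewrite -[X in X == _]addr0 (inj_eq (addrI _)) lt_eqF.
Qed.

(** At most one gap is nonzero, so of the gaps between two positions and the
    remaining ones, one family vanishes. *)
Lemma vertex_torus_diag (S : {set 'I_n}) (v : alcove R n) (a b : 'I_n) :
  open_face S = [set v] -> torus_diag v a = torus_diag v b.
Proof.
move=> Sv; wlog ab : a b / (a <= b)%N => [h|].
  by have [|/ltnW] := leqP a b => ab; [|symmetry]; exact: h.
have fv : open_face S v by rewrite Sv.
apply/eqP; rewrite (torus_diag_eq fv) //.
have [//|/forallPn[j1]] := boolP [forall j, between a b j ==> (j \in S)].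
rewrite negb_imply => /andP[bj1 j1S] /=; apply/forallP => j2.
apply/implyP => bj2; have [lt|gt|/val_inj e] := ltngtP j1 j2.
- by have := vertex_unique_gap Sv lt; rewrite (negbTE j1S).
- by have := vertex_unique_gap Sv gt; rewrite (negbTE j1S) orbF.
- by rewrite -e bj1 in bj2.
Qed.

End Vertices.

(** * The toric quivers *)

Section ToricQuiver.
Variables (R : realType) (s : sqrt_branch R).

Lemma torus_diag_qtil n (theta : alcove R n) (a : 'I_n) :
  torus_diag theta a = (qtil theta a)^-1.
Proof. by rewrite torus_diagE /qtil expiN invrK. Qed.

Lemma qtil_eq n (theta : alcove R n) (a b : 'I_n) :
  (qtil theta a == qtil theta b) = (torus_diag theta a == torus_diag theta b).
Proof. by rewrite !torus_diag_qtil (inj_eq invr_inj). Qed.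

Lemma nuE n (theta : alcove R n) (m a : nat) : (a <= m)%N ->
  nu s theta m a.+1 = s (qtil theta m / qtil theta a - 1).
Proof. by move=> am; rewrite /nu prod_qrat. Qed.

(** The square of nu is the ratio of two eigenvalues minus 1. *)
Lemma nu_neq0 n (theta : alcove R n) (m a : 'I_n) : (a <= m)%N ->
  torus_diag theta m != torus_diag theta a -> nu s theta m a.+1 != 0.
Proof.
move=> am; rewrite -qtil_eq; apply: contra => /eqP nu0.
have := nu_sqr s theta am; rewrite nu0 mulr0 => /esym/eqP.
by rewrite subr_eq0 => /eqP/divr1_eq ->.
Qed.

(** The matrix is diagonal, with products of nu as entries; each factor compares
    an index inside the interval with one outside. *)
Lemma interval_inv_toric r q p (theta : alcove R (r + (q + p))) :
  let T := ord_interval (r + (q + p)) p (q + p) in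
  (forall a b, a \in T -> b \notin T -> torus_diag theta a != torus_diag theta b) ->
  interval_inv (toric_point s theta) != 0.
Proof.
set m := (q + p)%N; set n := (r + m)%N => T sep.
have mn : (m <= n)%N := leq_addl _ _; have pm : (p <= m)%N := leq_addl _ _.
rewrite /interval_inv /interval_mx.
rewrite (@down_diag _ n _ _ _ (fun i a => nu s theta i a.+1)) //.
rewrite (@up_diag _ n _ _ _ (fun i a => nu s theta i a.+1)) //.
pose d a := if (a < p)%N then \prod_(p <= i < m) nu s theta i a.+1
            else \prod_(m <= i < n) nu s theta i a.+1.
rewrite (_ : _ + _ = diag_mx (\row_(a < m) d a)); last first.
  rewrite (@part_id_diag R[i] _ _ _ _ (fun a => \prod_(p <= i < m) nu s theta i a.+1)).
  rewrite (@part_id_diag R[i] _ _ _ _ (fun a => \prod_(m <= i < n) nu s theta i a.+1)).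
  apply/matrixP => a b; rewrite !mxE /d (leq_trans (ltn_ord a) mn) andbT /=.
  rewrite -(inj_eq val_inj) /=.
  case: eqVneq => _; case: ltnP => _; by rewrite ?addr0 ?add0r.
rewrite det_diag; apply/prodf_neq0 => a _; rewrite mxE /d.
have an : (a < n)%N := leq_trans (ltn_ord a) mn.
(* Exactly one of i and a lies in the interval, so their colors differ. *)
have nz i : (i < n)%N -> (a <= i)%N ->
    ((p <= i < m)%N != (p <= a < m)%N) -> nu s theta i a.+1 != 0.
  move=> iN ai; set i' := Ordinal iN; set a' := Ordinal an => ia.
  apply: (@nu_neq0 n theta i' a' ai).
  have [iT|iT] := boolP (i' \in T).
    apply: sep => //; apply: contra ia; move: iT; rewrite !inE /=.
    by move=> -> ->.
  rewrite eq_sym; apply: sep => //; move: iT ia; rewrite !inE /=.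
  by move=> /negbTE ->; case: (_ && _).
case: ifP => ap.
  rewrite prodf_seq_neq0; apply/allP => i; rewrite mem_index_iota => /andP[pi im].
  apply: nz; [exact: leq_trans im mn|exact: leq_trans (ltnW ap) pi|].
  by rewrite pi im leqNgt ap.
rewrite prodf_seq_neq0; apply/allP => i; rewrite mem_index_iota => /andP[mi iN].
apply: nz => //; first exact: leq_trans (ltnW (ltn_ord a)) mi.
by rewrite [(i < m)%N]ltnNge mi andbF ltn_ord andbT leqNgt ap.
Qed.

Lemma toric_block_det n r q p (theta : alcove R n) (k : SU R[i] n)
    (T : {set 'I_n}) :
  n = (r + (q + p))%N -> T = ord_interval n p (q + p) ->
  (forall a b, a \in T -> b \notin T -> torus_diag theta a != torus_diag theta b) ->
  block_centralizer (torus_diag theta) k ->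
  qact k (qclass (toric_point s theta)) = qclass (toric_point s theta) ->
  block_det T (val k) = 1.
Proof.
move=> nE TE; subst n => sep kt kA.
apply: (block_det_stab TE) kA; last first.
  by apply: interval_inv_toric; rewrite -TE.
apply/matrixP => a b; rewrite coord_projE coord_projEl.
have [aT|aT] := boolP (a \in T); have [bT|bT] := boolP (b \in T) => //.
  by rewrite kt ?mul0rn // sep.
by rewrite kt ?mul0rn // eq_sym sep.
Qed.

End ToricQuiver.

Section Stabilizers.
Variables (R : realType) (N : nat) (s : sqrt_branch R).
Local Notation n := N.+1.
Implicit Types (theta : alcove R n) (k : SU R[i] n).

(** Stabilizers are subgroups, so it is enough to treat commutators of elements
    of K_theta. *)
Lemma KK_stab theta k : KK theta k ->
  qact k (qclass (toric_point s theta)) = qclass (toric_point s theta).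
Proof.
apply: (smallest_sub (qact_stab_subgroup (qclass (toric_point s theta)))).
rewrite centralizer_torusE => _ [x Kx [y Ky <-]] /=.
pose t := qtil theta.
have bd (l : SU R[i] n) : block_centralizer (torus_diag theta) l ->
    block_diag (fun i : 'I_n => t i) (val l).
  by move=> Kl a b; rewrite /t qtil_eq => /Kl.
apply: (@diag_quiver_stab _ _ N t _ (fun i z => s (t i / z - 1))).
- by move=> i; rewrite divff ?qtil_neq0 // subrr branch0.
- move=> i; apply/matrixP => a b; rewrite !mxE; case: ifP => // _.
  by rewrite nuE // ltnW.
- move=> i; apply/matrixP => a b; rewrite !mxE; case: ifP => // _.
  by rewrite nuE // ltnW.
- apply: subgroup_commg (bd _ Kx) (bd _ Ky).
  exact: block_centralizer_subgroup.
- by move=> m mn; apply: det_corner_commg mn (bd _ Kx) (bd _ Ky).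
Qed.

Lemma top_mx_toric theta :
  top_mx (toric_point s theta) = qtil theta N *: torus theta - 1%:M.
Proof.
have h := toric_alpha_beta s theta (ord_max : 'I_n).
apply: (addrI 1%:M); rewrite [RHS]addrC subrK /top_mx.
rewrite (alpha_atE _ ord_max) (beta_atE _ ord_max) [LHS]h.
have qV (a : 'I_n) : (qtil theta a)^-1 = expi (Defs.coord (val theta) (n - a)).
  by rewrite -torus_diag_qtil torus_diagE.
by apply/matrixP => a b; rewrite !mxE qV mulrnAr.
Qed.

Lemma stab_centralizer theta k :
  qact k (qclass (toric_point s theta)) = qclass (toric_point s theta) ->
  centralizer_torus theta k.
Proof.
move=> /top_mx_qact; rewrite !top_mx_toric /centralizer_torus /=.
move=> /(congr1 (mulmxr (val k))) /=; rewrite mulmxKV ?su_unit //.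
rewrite mulmxBr mulmxBl mulmx1 mul1mx => /addIr.
rewrite -scalemxAr -scalemxAl => /(can_inj (scalerK _)); apply.
exact: qtil_neq0.
Qed.

Lemma eigen_block_interval theta z :
  exists2 T : {set 'I_n}, T = eigen_block theta z \/ T = ~: eigen_block theta z &
  exists r q p, n = (r + (q + p))%N /\ T = ord_interval n p (q + p).
Proof.
have := expi_level_interval z (phase_homo theta) (phase_width theta).
rewrite (_ : color_class _ z = eigen_block theta z) //.
by apply/setP => a; rewrite !inE -torus_diagE.
Qed.

(** The block determinants are 1 by toric_block_det when the block is an
    interval, and through det k = 1 when its complement is. *)
Lemma stab_KK theta k :
  qact k (qclass (toric_point s theta)) = qclass (toric_point s theta) ->
  KK theta k.
Proof.
move=> kA; have Kk := stab_centralizer kA.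
rewrite KK_E // ; rewrite centralizer_torusE in Kk; split=> // z.
have [T Tz [r [q [p [nE TE]]]]] := eigen_block_interval theta z.
have sep a b : a \in T -> b \notin T -> torus_diag theta a != torus_diag theta b.
  have E (x : 'I_n) : (x \in eigen_block theta z) = (torus_diag theta x == z).
    by rewrite inE.
  move=> aT bT; apply/eqP => ab; move: aT bT.
  by case: Tz => ->; rewrite ?finset.in_setC !E ab; case: (_ == z).
have T1 := toric_block_det nE TE sep Kk kA.
case: Tz => Tz; first by rewrite -[color_class _ _]/(eigen_block theta z) -Tz.
have /block_diag_proj/(_ z) kz := Kk.
have := block_det_setC kz; rewrite -[X in ~: X]/(eigen_block theta z) -Tz T1 mulr1.
by move=> <-; have /andP[_ /eqP] := valP k.
Qed.

Lemma stabE theta k :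
  qact k (qclass (toric_point s theta)) = qclass (toric_point s theta) <->
  KK theta k.
Proof. by split; [exact: stab_KK|exact: KK_stab]. Qed.

Lemma orbit_point_eq k k' theta theta' :
  orbit_point s k theta = orbit_point s k' theta' <->
  theta = theta' /\ KK theta (k^-1 * k')%g.
Proof.
rewrite /orbit_point; split=> [e|[<- /stabE kA]]; last first.
  by rewrite -[in LHS]kA qactM mulVKg.
have thE : theta = theta'.
  apply: torus_inj; congr diag_mx; apply/rowP => a; rewrite !mxE.
  have := qscal_qact e a; rewrite /= /qtil !expiN => /invr_inj.
  exact.
split=> //; apply/stabE; rewrite -thE in e.
by rewrite -qactM -e qactM mulVg qact1.
Qed.

Lemma orbit_pointM g k theta :
  orbit_point s (g * k)%g theta = qact g (orbit_point s k theta).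
Proof. by rewrite /orbit_point qactM. Qed.

End Stabilizers.

Section Faces.
Variables (R : realType) (n : nat).
Implicit Types (theta : alcove R n) (S : {set 'I_n}).

Lemma open_face_torus_diag S theta theta0 (a b : 'I_n) :
  open_face S theta -> open_face S theta0 ->
  (torus_diag theta a == torus_diag theta b) =
  (torus_diag theta0 a == torus_diag theta0 b).
Proof.
move=> fS fS0; wlog ab : a b / (a <= b)%N => [h|].
  by have [|/ltnW] := leqP a b => ab; [|rewrite eq_sym [RHS]eq_sym]; exact: h.
by rewrite !(torus_diag_eq (S := S)).
Qed.

Lemma open_face_eigen_block S theta theta0 (a : 'I_n) :
  open_face S theta -> open_face S theta0 ->
  eigen_block theta (torus theta a a) = eigen_block theta0 (torus theta0 a a).
Proof.
by move=> fS fS0; apply/setP => b; rewrite !inE; exact: open_face_torus_diag fS fS0.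
Qed.

Lemma open_face_KK S theta theta0 :
  open_face S theta -> open_face S theta0 -> KK theta = KK theta0.
Proof.
move=> fS fS0; rewrite /KK; congr commutator_subgroup.
rewrite !centralizer_torusE; apply/seteqP; split=> k kt a b.
  by rewrite -(open_face_torus_diag _ _ fS fS0); exact: kt.
by rewrite (open_face_torus_diag _ _ fS fS0); exact: kt.
Qed.

Lemma interior_torus_diag_inj theta (a b : 'I_n) :
  open_face finset.set0 theta -> torus_diag theta a = torus_diag theta b -> a = b.
Proof.
move=> f0; wlog ab : a b / (a < b)%N => [h|].
  by case: (ltngtP a b) => [/h h' /h'|/h h' /esym/h'|/val_inj].
move=> /eqP; rewrite (torus_diag_eq f0) ?(ltnW ab) //.
have bn := ltn_ord b; have n0 : (0 < n)%N := leq_ltn_trans (leq0n b) bn.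
have jn : (n - b.+1 < n)%N by rewrite ltn_subrL.
have ln : (n.-1 < n)%N by rewrite prednK.
case/orP => /forallP h; [have := h (Ordinal jn)|have := h (Ordinal ln)].
  by rewrite inE implybF /between /= -subSn // subSS leqnn ltn_sub2l // (ltn_trans ab).
by rewrite inE implybF negbK /between /= prednK // ltnNge !leq_subr.
Qed.

(** In the interior the eigenvalues are distinct, so K_theta consists of
    diagonal matrices and is abelian. *)
Lemma KK_interior theta k : open_face finset.set0 theta -> KK theta k -> k = 1%g.
Proof.
move=> f0; apply: (@smallest_sub _ _ _ [set 1%g]) => [|_ [x Kx [y Ky <-]]].
  by split=> //= [x y -> ->|x ->]; [exact: mulg1|exact: invg1].
have diagK l : centralizer_torus theta l ->
    val l = diag_mx (\row_a val l a a).
  rewrite centralizer_torusE => Kl; apply/matrixP => a b; rewrite !mxE.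
  have [->|ab] := eqVneq a b; first by rewrite mulr1n.
  by rewrite mulr0n Kl //; apply: contra ab => /eqP/(interior_torus_diag_inj f0) ->.
apply/eqP/commgP; rewrite /commute; apply/val_inj.
by rewrite !val_suM (diagK _ Kx) (diagK _ Ky) diag_mxC.
Qed.

Lemma face_point_ex S (y : Yface R S) :
  exists theta, open_face S theta /\ torus theta = val y.
Proof. by have /asboolP[theta fS e] := valP y; exists theta. Qed.

Definition face_point S (y : Yface R S) : alcove R n :=
  projT1 (cid (face_point_ex y)).

Lemma face_pointP S (y : Yface R S) :
  open_face S (face_point y) /\ torus (face_point y) = val y.
Proof. exact: projT2 (cid (face_point_ex y)). Qed.

Lemma face_pointE S (y : Yface R S) theta : val y = torus theta ->
  face_point y = theta.
Proof. by move=> e; apply: torus_inj; have [_ ->] := face_pointP y. Qed.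

Lemma YfaceP S theta : open_face S theta ->
  exists y : Yface R S, val y = torus theta.
Proof.
move=> fS.
have yP : `[< exists2 th, open_face S th & torus th = torus theta >].
  by apply/asboolP; exists theta.
by exists (exist (fun y => is_true `[< exists2 th, open_face S th & torus th = y >])
  (torus theta) yP).
Qed.

End Faces.

(** * Strata of the swept set *)

Section Strata.
Variables (R : realType) (N : nat) (s : sqrt_branch R).
Local Notation n := N.+1.
Implicit Types (theta : alcove R n) (S : {set 'I_n}).
Local Open Scope quotient_scope.

Lemma implosion_bijection :
  exists Phi : implosion R n -> qmult R[i] n,
   [/\ forall k theta, Phi (imp_class k theta) = orbit_point s k theta,
       set_bij [set: implosion R n] (sweep s [set: alcove R n]) Phi,
       forall g x, Phi (imp_act g x) = qact g (Phi x) &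
       forall S : {set 'I_n}, Phi @` imp_stratum S = sweep s (open_face S)].
Proof.
pose Phi (x : implosion R n) := orbit_point s (repr x).1 (repr x).2.
have PhiE k theta : Phi (imp_class k theta) = orbit_point s k theta.
  rewrite /Phi /imp_class; case: piP => -[k' th'] /= h.
  by apply/esym/orbit_point_eq/imp_classP.
have impE (x : implosion R n) : x = imp_class (repr x).1 (repr x).2.
  by rewrite /imp_class -surjective_pairing reprK.
exists Phi; split=> //.
- split.
  + by move=> x _ /=; exists (repr x).
  + by move=> x y _ _; rewrite (impE x) (impE y) !PhiE => /orbit_point_eq/imp_classP.
  + by move=> _ [[k th] _ <-] /=; exists (imp_class k th); rewrite ?PhiE.
- by move=> g x; rewrite (impE x) imp_actE !PhiE orbit_pointM.
- move=> S; apply/seteqP; split=> [_ [_ [[k th] /= [_ fS] <-] <-]|].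
    by rewrite PhiE; exists (k, th).
  move=> _ [[k th] /= [_ fS] <-].
  by exists (imp_class k th); rewrite ?PhiE //; exists (k, th).
Qed.

Lemma sweep_open_faces :
  \bigcup_(S in [set: {set 'I_n}]) sweep s (open_face S) = sweep s [set: alcove R n]
  /\ trivIset [set: {set 'I_n}] (fun S => sweep s (open_face S)).
Proof.
split.
  apply/seteqP; split=> [_ [S _ [[k th] _ <-]]|_ [[k th] _ <-]].
    by exists (k, th).
  exists (finset (fun j : 'I_n => gap (val th) j.+1 == 0)) => //.
  by exists (k, th) => //; split=> //; exact: open_face_zero_gaps.
move=> S S' _ _ [_ [[[k th] [_ fS] <-] [[k' th'] [_ fS'] /orbit_point_eq[e _]]]].
by apply: open_face_inj fS _; rewrite /= in e fS'; rewrite -e.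
Qed.

Lemma orbit_point_KK k l theta : KK theta l ->
  orbit_point s (k * l)%g theta = orbit_point s k theta.
Proof. by move=> /KK_stab kA; rewrite /orbit_point -qactM kA. Qed.

(** [K_theta, K_theta] is the same for all theta in the face and acts trivially
    on the second factor, so both quotients identify the same pairs. *)
Lemma stratum_bundle S theta0 : open_face S theta0 ->
  exists Psi : bundle theta0 S -> qmult R[i] n,
   [/\ forall k theta (y : Yface R S),
         open_face S theta -> val y = torus theta ->
         Psi (bundle_class theta0 k y) = orbit_point s k theta,
       set_bij [set: bundle theta0 S] (sweep s (open_face S)) Psi &
       forall g x, Psi (bundle_act g x) = qact g (Psi x)].
Proof.
move=> fS0.
pose Psi (x : bundle theta0 S) :=
  orbit_point s (repr x).1 (face_point (repr x).2).
have KE (y : Yface R S) : KK (face_point y) = KK theta0.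
  by have [fS _] := face_pointP y; exact: open_face_KK fS fS0.
have KV l : KK theta0 l -> KK theta0 l^-1%g.
  by have [_ _] := commutator_subgroupP (centralizer_torus theta0); apply.
(* l commutes with y, so the second component of a bundle point is constant *)
have conjK (l : SU R[i] n) (y : Yface R S) : KK theta0 l ->
    val l *m val y *m invmx (val l) = val y.
  rewrite -(KE y) => /KK_centralizer; rewrite /centralizer_torus /=.
  by have [_ ->] := face_pointP y => ->; rewrite mulmxK ?su_unit.
have PsiE k y :
    Psi (bundle_class theta0 k y) = orbit_point s k (face_point y).
  rewrite /Psi /bundle_class; case: piP => -[k' y'] /eqmodP/asboolP[l Kl /= [-> ye]].
  have -> : y' = y by apply/val_inj; exact: etrans ye (conjK _ _ Kl).
  by apply: orbit_point_KK; rewrite KE; exact: KV.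
have bundleE (x : bundle theta0 S) : x = bundle_class theta0 (repr x).1 (repr x).2.
  by rewrite /bundle_class -surjective_pairing reprK.
exists Psi; split.
- by move=> k th y fS ye; rewrite PsiE (face_pointE ye).
- split.
  + move=> x _ /=; exists ((repr x).1, face_point (repr x).2) => //.
    by split=> //; case: (face_pointP (repr x).2).
  + move=> x x' _ _; rewrite (bundleE x) (bundleE x') !PsiE.
    set y := (repr x).2; set y' := (repr x').2.
    move=> /orbit_point_eq[ye]; rewrite KE => Kl.
    have -> : y' = y.
      apply/val_inj; have [_ <-] := face_pointP y'.
      by have [_ <-] := face_pointP y; rewrite ye.
    apply/eqmodP/asboolP; exists (((repr x).1)^-1 * (repr x').1)^-1%g.
      exact: KV.
    rewrite /= invgK mulVKg; split=> //; apply/esym.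
    exact: (conjK _ y (KV _ Kl)).
  + move=> _ [[k th] [_ fS] <-] /=; have [y ye] := YfaceP fS.
    by exists (bundle_class theta0 k y); rewrite ?PsiE ?(face_pointE ye).
- by move=> g x; rewrite (bundleE x) bundle_actE !PsiE orbit_pointM.
Qed.

Lemma open_stratum_bijection :
  exists Psi0 : SU R[i] n * Yface R (finset.set0 : {set 'I_n}) ->
                 qmult R[i] n,
     [/\ forall k theta y,
           open_face finset.set0 theta -> val y = torus theta ->
           Psi0 (k, y) = orbit_point s k theta,
         set_bij setT (sweep s (open_face finset.set0)) Psi0 &
         forall g k y, Psi0 ((g * k)%g, y) = qact g (Psi0 (k, y))].
Proof.
exists (fun x => orbit_point s x.1 (face_point x.2)); split=> /=.
- by move=> k th y _ ye; rewrite (face_pointE ye).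
- split.
  + move=> [k y] _ /=; exists (k, face_point y) => //.
    by split=> //; case: (face_pointP y).
  + move=> [k y] [k' y'] _ _ /= /orbit_point_eq[ye].
    have [f0 yE] := face_pointP y; move=> /(KK_interior f0) kk.
    have -> : y' = y.
      by apply/val_inj; have [_ <-] := face_pointP y'; rewrite -ye.
    by rewrite -[k']mul1g -(mulgV k) -mulgA kk mulg1.
  + move=> _ [[k th] [_ f0] <-] /=; have [y ye] := YfaceP f0.
    by exists (k, y); rewrite //= (face_pointE ye).
- by move=> g k y; rewrite orbit_pointM.
Qed.

Lemma KK_vertex S (v : alcove R n) k : open_face S = [set v] -> KK v k.
Proof.
move=> Sv; rewrite KK_E //; split=> [a b|z].
  by rewrite (vertex_torus_diag a b Sv) eqxx.
have [->|zb] := eqVneq z (torus_diag v ord0).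
  rewrite (_ : color_class _ _ = finset.setTfor 'I_n).
    by rewrite block_detT; have /andP[_ /eqP] := valP k.
  by apply/setP => a; rewrite !inE (vertex_torus_diag a ord0 Sv) eqxx.
rewrite (_ : color_class _ _ = finset.set0) ?block_det0 //.
by apply/setP => a; rewrite !inE (vertex_torus_diag a ord0 Sv) eq_sym (negbTE zb).
Qed.

Lemma sweep_vertex S (v : alcove R n) : open_face S = [set v] ->
  exists p : qmult R[i] n, sweep s (open_face S) = [set p].
Proof.
move=> Sv; exists (orbit_point s 1%g v).
apply/seteqP; split=> [_ [[k th] [_ +] <-]|_ ->] /=.
  rewrite Sv => /= ->; apply/orbit_point_eq; split=> //.
  exact: KK_vertex Sv.
by exists (1%g, v) => //; split=> //; rewrite Sv.
Qed.

End Strata.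

Theorem mainTheorem3 (R : realType) (n : nat) (hn : (2 <= n)%N)
    (s : sqrt_branch R) :
  (forall (k k' : SU R[i] n) (theta theta' : alcove R n),
     orbit_point s k theta = orbit_point s k' theta' <->
     theta = theta' /\ KK theta (k^-1 * k')%g)
  /\
  (exists Phi : implosion R n -> qmult R[i] n,
     [/\ forall k theta, Phi (imp_class k theta) = orbit_point s k theta,
         set_bij [set: implosion R n] (sweep s [set: alcove R n]) Phi,
         forall g x, Phi (imp_act g x) = qact g (Phi x) &
         forall S : {set 'I_n}, Phi @` imp_stratum S = sweep s (open_face S)])
  /\
  (\bigcup_(S in [set: {set 'I_n}]) sweep s (open_face S) =
     sweep s [set: alcove R n]
   /\ trivIset [set: {set 'I_n}] (fun S => sweep s (open_face S)))
  /\
  (forall (S : {set 'I_n}) (theta0 : alcove R n), open_face S theta0 ->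
     (forall theta : alcove R n, open_face S theta ->
        [/\ forall a : 'I_n, eigen_block theta (torus theta a a) =
                             eigen_block theta0 (torus theta0 a a),
            KK theta = KK theta0 & KK theta = block_SU theta])
     /\
     exists Psi : bundle theta0 S -> qmult R[i] n,
       [/\ forall k theta (y : Yface R S),
             open_face S theta -> val y = torus theta ->
             Psi (bundle_class theta0 k y) = orbit_point s k theta,
           set_bij [set: bundle theta0 S] (sweep s (open_face S)) Psi &
           forall g x, Psi (bundle_act g x) = qact g (Psi x)])
  /\
  (exists Psi0 : SU R[i] n * Yface R (finset.set0 : {set 'I_n}) ->
                 qmult R[i] n,
     [/\ forall k theta y,
           open_face finset.set0 theta -> val y = torus theta ->
           Psi0 (k, y) = orbit_point s k theta,
         set_bij setT (sweep s (open_face finset.set0)) Psi0 &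
         forall g k y, Psi0 ((g * k)%g, y) = qact g (Psi0 (k, y))])
  /\
  (forall (S : {set 'I_n}) (v : alcove R n), open_face S = [set v] ->
     exists p : qmult R[i] n, sweep s (open_face S) = [set p]).
Proof.
case: n hn => [//|N] _.
split; first exact: orbit_point_eq.
split; first exact: implosion_bijection.
split; first exact: sweep_open_faces.
split.
  move=> S theta0 fS0; split=> [theta fS|]; last exact: stratum_bundle.
  split; last by rewrite KK_E // block_SUE.
  - by move=> a; exact: open_face_eigen_block fS fS0.
  - exact: open_face_KK fS fS0.
split; first exact: open_stratum_bijection.
exact: sweep_vertex.
Qed.
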